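(* Let $n>m$ and let $\mathsf{A}\in\mathbb{R}^{n\times m}$ be an over-determined matrix with full column rank. Let $\mathcal{A}=\mathbb{R}^m$, let $\mathcal{G}(u)=\mathsf{A}u$, and let $D$ be the quadratic Wasserstein metric $W_2$. Assume that the reference data distribution $\rho_y^*$ on $\mathbb{R}^n$ is absolutely continuous with respect to the Lebesgue measure and supported on $\mathcal{R}$, the closure of a bounded connected open set. Then: (i) The variational problem $$\min_{\rho_u\in\mathcal{P}(\mathcal{A})}W_2(\mathsf{A}_\sharp\rho_u,\rho_y^* )$$ has a unique minimizer $\mathsf{A}^\dagger_\sharp\rho_y^*$. (ii) The Wasserstein gradient flow $$\partial_t\rho_u=\nabla_u\cdot\big(\rho_u\nabla_u\,\phi^*(\mathsf{A}u)\big),$$ where $\phi^*$ is the Kantorovich potential associated with $\rho_y=\mathsf{A}_\sharp\rho_u$ in the optimal transport between $\rho_y$ and $\rho_y^*$, has a unique equilibrium, which is also the unique minimizer: $\rho_u^\infty=\mathsf{A}^\dagger_\sharp\rho_y^*$.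
   Context: $\mathcal{P}(\mathcal{A})$ denotes all probability distributions over $\mathcal{A}$. $\mathsf{A}_\sharp$ is push-forward under $u\mapsto\mathsf{A}u$, and $\mathsf{A}^\dagger=(\mathsf{A}^\top\mathsf{A})^{-1}\mathsf{A}^\top$. For a cost $\mathsf{c}(x,y)$ (here quadratic, $\mathsf{c}(x,y)=|x-y|^2$ up to a positive constant factor), the optimal transport discrepancy is $\inf_{\gamma\in\Gamma(\rho_y,\rho_y^* )}\int\mathsf{c}(x,y)\,\mathrm{d}\gamma$ over couplings $\gamma$, and by Kantorovich duality it equals $\sup\big\{\int\phi\,\rho_y\,\mathrm{d}x+\int\psi\,\rho_y^*\,\mathrm{d}y:\ \phi(x)+\psi(y)\le\mathsf{c}(x,y)\ \forall x,y\big\}$. A maximizing pair $(\phi^*,\psi^* )$ is called the Kantorovich potentials, and $\phi^*$ is the first variation $\frac{\delta D}{\delta\rho_y}$ of the discrepancy with respect to $\rho_y$. The flow in (ii) is the Wasserstein ($W_2$) gradient flow $\partial_t\rho_u=\nabla_u\cdot(\rho_u\nabla_u\frac{\delta E}{\delta\rho_u})$ of $E(\rho_u)=D(\mathsf{A}_\sharp\rho_u,\rho_y^* )$, using $\frac{\delta E}{\delta\rho_u}(u)=\phi^*(\mathsf{A}u)$. An equilibrium $\rho_u^\infty$ is a stationary state of the flow, satisfying $\nabla_u\frac{\delta E}{\delta\rho_u}\big|_{\rho_u^\infty}=0$ on the support of $\rho_u^\infty$, i.e. $\mathsf{A}^\top\nabla_y\phi^*(y)=0$ on the support of $\rho_y^\infty=\mathsf{A}_\sharp\rho_u^\infty$,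 with $\phi^*$ the potential associated with $\rho_y^\infty$. *)

(* Defs.v *)
From HB Require Import structures.
From mathcomp Require Import all_boot all_order all_algebra.
From mathcomp Require Import all_classical all_reals all_analysis.

Set Implicit Arguments.
Unset Strict Implicit.
Unset Printing Implicit Defensive.

Import Order.TTheory GRing.Theory Num.Theory.
Import numFieldNormedType.Exports.

Local Open Scope classical_set_scope.
Local Open Scope ring_scope.

(* R^n is 'cV[R]_n.  Matrix spaces carry the Borel sigma-algebra of their
   (product) topology. *)
HB.instance Definition _ (R : realType) (m n : nat) :=
  Measurable.copy 'M[R]_(m, n) (g_sigma_algebraType (@open 'M[R]_(m, n))).

Lemma continuous_mulmx (R : realType) (m n p : nat) (A : 'M[R]_(m, n)) :
  continuous (mulmx A : 'M[R]_(n, p) -> 'M[R]_(m, p)).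
Proof.
move=> u P [Q Qu QP].
have Q_near (ij : 'I_m * 'I_p) :
    \forall v \near u, Q ij.1 ij.2 ((A *m v) ij.1 ij.2).
  case: ij => i j /=.
  have cij : {for u, continuous (fun v : 'M[R]_(n, p) => (A *m v) i j)}.
    rewrite (_ : (fun v => (A *m v) i j) =
        fun v : 'M[R]_(n, p) => \sum_(k < n) A i k * v k j); last first.
      by apply/funext => v; rewrite mxE.
    apply: cvg_big => [||k _]; [exact: add_continuous|exact: nbhs_filter|].
    have /= ckj := @coord_continuous R n p k j u.
    exact: (@cvgMl_tmp _ _ _ (nbhs_filter u) _ (A i k) _ ckj).
  by apply: cij; exact: Qu.
have := filter_forall (nbhs_filter u) Q_near.
by apply: filterS => v Qv; apply: QP => i j; exact: (Qv (i, j)).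
Qed.

Lemma measurable_mulmx (R : realType) (m n p : nat) (A : 'M[R]_(m, n)) :
  measurable_fun [set: 'M[R]_(n, p)] (mulmx A : _ -> 'M[R]_(m, p)).
Proof.
apply: (measurability (@open 'M[R]_(m, p))) => // _ [B oB <-].
rewrite setTI; apply: sub_sigma_algebra.
by apply: open_comp => // ? _; exact: continuous_mulmx.
Qed.

HB.instance Definition _ (R : realType) (m n p : nat) (A : 'M[R]_(m, n)) :=
  isMeasurableFun.Build _ _ 'M[R]_(n, p) 'M[R]_(m, p) (mulmx A)
    (@measurable_mulmx R m n p A).

Section Measures.
Context {R : realType}.

Definition push (m n : nat) (A : 'M[R]_(n, m)) (rho : probability 'cV[R]_m R)
    : probability 'cV[R]_n R :=
  distribution rho (mulmx A).

(* Equality as Borel measures: library measures are functions on all subsets,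
   with irrelevant values on the non-measurable ones. *)
Definition eq_prob (n : nat) (mu nu : probability 'cV[R]_n R) : Prop :=
  forall B, measurable B -> mu B = nu B.

Definition msupport (n : nat) (mu : probability 'cV[R]_n R) : set 'cV[R]_n :=
  [set x | forall V, open V -> V x -> (0 < mu V)%E].

Definition box (n : nat) (a b : 'cV[R]_n) : set 'cV[R]_n :=
  [set x | forall i, a i 0 <= x i 0 < b i 0].

(* n-dimensional Lebesgue outer measure; on Borel sets it is the Lebesgue
   measure. *)
Definition lebesgue_outer (n : nat) (X : set 'cV[R]_n) : \bar R :=
  ereal_inf [set l | exists a b : nat -> 'cV[R]_n,
    [/\ forall k i, a k i 0 <= b k i 0,
        X `<=` \bigcup_k box (a k) (b k) &
        l = (\sum_(0 <= k <oo) (\prod_i (b k i 0 - a k i 0))%:E)%E]].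

End Measures.

Definition dotp (R : realType) (n : nat) (x y : 'cV[R]_n) : R :=
  \sum_i x i 0 * y i 0.

(* The norm of 'cV[R]_n in the library is the sup norm, hence this explicit
   Euclidean cost. *)
Definition cost (R : realType) (n : nat) (x y : 'cV[R]_n) : R :=
  dotp (x - y) (x - y).

Definition gradient (R : realType) (n : nat) (f : 'cV[R]_n -> R)
    (u : 'cV[R]_n) : 'cV[R]_n :=
  \col_i 'D_(delta_mx i 0) f u.

Definition left_pinv (R : realType) (m n : nat) (A : 'M[R]_(n, m)) : 'M[R]_(m, n) :=
  invmx (A^T *m A) *m A^T.

Section OptimalTransport.
Context {R : realType} {n : nat}.
Implicit Types mu nu : probability 'cV[R]_n R.
Local Open Scope ereal_scope.

Definition coupling mu nu
    (gamma : probability ('cV[R]_n * 'cV[R]_n)%type R) : Prop :=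
  (forall B, measurable B -> pushforward gamma fst B = mu B) /\
  (forall B, measurable B -> pushforward gamma snd B = nu B).

Definition W2 mu nu : \bar R :=
  sqrte (ereal_inf [set \int[gamma]_z (cost z.1 z.2)%:E
                   | gamma in coupling mu nu]).

(* Values -oo are allowed.  A value +oo is impossible: it would force the other
   function to be -oo everywhere, hence not integrable. *)
Definition dual_admissible mu nu (phi psi : 'cV[R]_n -> \bar R) : Prop :=
  [/\ mu.-integrable setT phi, nu.-integrable setT psi &
      forall x y, phi x + psi y <= (cost x y)%:E].

Definition dual_value mu nu (phi psi : 'cV[R]_n -> \bar R) : \bar R :=
  \int[mu]_x phi x + \int[nu]_y psi y.

Definition kantorovich_pair mu nu (phi psi : 'cV[R]_n -> \bar R) : Prop :=
  dual_admissible mu nu phi psi /\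
  forall phi' psi', dual_admissible mu nu phi' psi' ->
    dual_value mu nu phi' psi' <= dual_value mu nu phi psi.

(* phi is the potential representing the first variation of the transport cost
   with respect to mu.  The values of a maximizing phi on a mu-null set are
   arbitrary, so phi is normalized as the c-transform of its partner over the
   support of nu; when that support is the closure of a bounded connected open
   set, this determines phi up to an additive constant. *)
Definition kantorovich_potential mu nu (phi : 'cV[R]_n -> R) : Prop :=
  exists2 psi : 'cV[R]_n -> \bar R,
    kantorovich_pair mu nu (EFin \o phi) psi &
    forall x, (phi x)%:E =
      ereal_inf [set (cost x y)%:E - psi y | y in msupport nu].

End OptimalTransport.

Section GradientFlow.
Context {R : realType} {m n : nat}.
Variables (A : 'M[R]_(n, m)) (rho_star : probability 'cV[R]_n R).

Definition W2_minimizer (rho : probability 'cV[R]_m R) : Prop :=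
  forall rho' : probability 'cV[R]_m R,
    (W2 (push A rho) rho_star <= W2 (push A rho') rho_star)%E.

Definition test_function (zeta : 'cV[R]_m -> R) : Prop :=
  [/\ forall u, differentiable zeta u, continuous (gradient zeta) &
      compact (closure [set u | zeta u != 0])].

(* Weak solutions on [0, +oo[ of
     d_t rho = div (rho grad (phi_t o A)),
   i.e. of the continuity equation d_t rho + div (rho v) = 0 with velocity
   v = - grad (phi_t o A). *)
Definition gradient_flow (rho : R -> probability 'cV[R]_m R) : Prop :=
  exists v : R -> 'cV[R]_m -> 'cV[R]_m,
  [/\ forall t : R, 0 < t ->
        exists2 phi, kantorovich_potential (push A (rho t)) rho_star phi &
          {ae rho t, forall u, differentiable (phi \o mulmx A) u /\
                               v t u = - gradient (phi \o mulmx A) u},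
      forall t : R, 0 < t -> measurable_fun setT (v t) /\
        (rho t).-integrable setT (fun u => (dotp (v t u) (v t u))%:E) &
      forall zeta, test_function zeta -> forall s t : R, 0 <= s <= t ->
        let rate r := \int[rho r]_u dotp (gradient zeta u) (v r u) in
        lebesgue_measure.-integrable `[s, t] (EFin \o rate) /\
        \int[rho t]_u zeta u - \int[rho s]_u zeta u =
          \int[lebesgue_measure]_(r in `[s, t]) rate r].

Definition equilibrium (rho : probability 'cV[R]_m R) : Prop :=
  gradient_flow (fun=> rho) /\
  exists2 phi, kantorovich_potential (push A rho) rho_star phi &
    forall u, msupport rho u ->
      differentiable (phi \o mulmx A) u /\ gradient (phi \o mulmx A) u = 0.

End GradientFlow.

(* Main.v *)
(* Write B for the left pseudo-inverse of A and nu for the data distribution.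
   By Pythagoras |A u - y|^2 = |A (u - B y)|^2 + gap y with
   gap y = |A B y - y|^2, so the transport cost from a measure on the range of A
   to nu is at least the integral G of gap, and y |-> A B y attains it.

   Uniqueness.  If no dual pair for (A_# rho, nu) has a value above G, then
   rho = B_# nu: for a Lipschitz h in [0, 1] the pair
     (s h(u), gap y - s h(B y) - C s^2)
   is admissible for every real s, whence s (int h drho - int h d(B_# nu)) <= C s^2
   and the two integrals agree.  Minimizers have this property by weak duality.

   Equilibria have it too.  Let g = phi o A and let T be the support of rho, where
   the gradient of g vanishes.  Strong duality is never used: T is compact, and
   replacing psi y by min_T (|A u - y|^2 - g u) does not decrease the dual value,
   so by optimality psi is almost everywhere this minimum; at a minimizer u the
   normal equation gives u = B y.  Hence g is critical on B (supp nu), so it is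
   constant there since U is connected.  Then g is that constant plus the squared
   distance to the image of supp nu, whose gradient vanishes on T only if this
   distance does; so g is constant on T and the dual value is G. *)
Require Import Defs.
From mathcomp Require Import all_boot all_order all_algebra.
From mathcomp Require Import all_classical all_reals all_analysis.
From mathcomp Require Import measurable_realfun ring lra.
Import Order.TTheory GRing.Theory Num.Theory.
Import numFieldNormedType.Exports.
Local Open Scope classical_set_scope.
Local Open Scope ring_scope.

Set Implicit Arguments.
Unset Strict Implicit.
Unset Printing Implicit Defensive.

(** * Projection onto the range of the matrix *)

Section Algebra.
Context {R : realType}.
Implicit Types n m : nat.

Lemma dotpC n (x y : 'cV[R]_n) : dotp x y = dotp y x.
Proof. by apply: eq_bigr => i _; rewrite mulrC. Qed.

Lemma dotpDl n (x y z : 'cV[R]_n) : dotp (x + y) z = dotp x z + dotp y z.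
Proof.
by rewrite /dotp -big_split; apply: eq_bigr => i _; rewrite mxE mulrDl.
Qed.

Lemma dotpDr n (x y z : 'cV[R]_n) : dotp z (x + y) = dotp z x + dotp z y.
Proof. by rewrite dotpC dotpDl !(dotpC z). Qed.

Lemma dotpZl n a (x y : 'cV[R]_n) : dotp (a *: x) y = a * dotp x y.
Proof.
by rewrite /dotp mulr_sumr; apply: eq_bigr => i _; rewrite mxE mulrA.
Qed.

Lemma dotpZr n a (x y : 'cV[R]_n) : dotp x (a *: y) = a * dotp x y.
Proof. by rewrite dotpC dotpZl dotpC. Qed.

Lemma dotpNl n (x y : 'cV[R]_n) : dotp (- x) y = - dotp x y.
Proof. by rewrite -scaleN1r dotpZl mulN1r. Qed.

Lemma dotpNr n (x y : 'cV[R]_n) : dotp x (- y) = - dotp x y.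
Proof. by rewrite dotpC dotpNl dotpC. Qed.

Lemma dotp_ge0 n (x : 'cV[R]_n) : 0 <= dotp x x.
Proof. by apply: sumr_ge0 => i _; rewrite -expr2 sqr_ge0. Qed.

Lemma dotp_eq0 n (x : 'cV[R]_n) : dotp x x = 0 -> x = 0.
Proof.
move=> /eqP; rewrite psumr_eq0 => [/allP x0|i _]; last by rewrite -expr2 sqr_ge0.
apply/matrixP => i j; rewrite ord1 mxE; apply/eqP.
by have := x0 i (mem_index_enum i); rewrite mulf_eq0 orbb.
Qed.

Lemma dotp_mulmxl m n (A : 'M[R]_(n, m)) u y :
  dotp (A *m u) y = dotp u (A^T *m y).
Proof.
have dotpE k (x z : 'cV[R]_k) : dotp x z = (x^T *m z) 0 0.
  by rewrite mxE; apply: eq_bigr => i _; rewrite mxE.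
by rewrite !dotpE trmx_mul mulmxA.
Qed.

Lemma cost_ge0 n (x y : 'cV[R]_n) : 0 <= cost x y.
Proof. exact: dotp_ge0. Qed.

Lemma costC n (x y : 'cV[R]_n) : cost x y = cost y x.
Proof. by rewrite /cost -(opprB y x) dotpNl dotpNr opprK. Qed.

(** Exact second-order expansion along a ray, shaped like the upper bound in [slope_ge0]. *)
Lemma cost_segment n (x y v : 'cV[R]_n) (t : R) :
  cost (x + t *: v) y = cost x y + t * (2 * dotp (x - y) v) + t ^+ 2 * dotp v v.
Proof.
rewrite /cost (_ : x + t *: v - y = (x - y) + t *: v); last by rewrite addrAC.
move: (x - y) => w; rewrite !(dotpDl, dotpDr, dotpZl, dotpZr) (dotpC v w).
ring.
Qed.

Section PseudoInverse.
Context {m n : nat} (A : 'M[R]_(n, m)).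
Hypothesis rankA : \rank A = m.

(** The Gram matrix [A^T *m A] is invertible: if it kills a row vector v, then |A v^T|^2 = 0, and
    full column rank of A forces v = 0. *)
Lemma left_pinvK : left_pinv A *m A = 1%:M.
Proof.
rewrite /left_pinv -mulmxA mulVmx //.
rewrite -row_free_unit; apply: inj_row_free => v vAA.
have /dotp_eq0 Av0 : dotp (A *m v^T) (A *m v^T) = 0.
  rewrite dotp_mulmxl (_ : A^T *m _ = (v *m (A^T *m A))^T); last first.
    by rewrite !trmx_mul trmxK mulmxA.
  rewrite vAA trmx0.
  by rewrite /dotp big1 // => i _; rewrite [X in _ * X]mxE mulr0.
have vA0 : v *m A^T = 0 by rewrite -[RHS]trmx0 -Av0 trmx_mul trmxK.
have freeA : row_free A^T by rewrite /row_free mxrank_tr rankA.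
by apply: (row_free_inj freeA); rewrite vA0 mul0mx.
Qed.

Lemma left_pinvKv (u : 'cV[R]_m) : left_pinv A *m (A *m u) = u.
Proof. by rewrite mulmxA left_pinvK mul1mx. Qed.

(** Geometrically, the residual A B y - y, with B the pseudo-inverse, is orthogonal to the range of
    A. *)
Lemma normal_equation (y : 'cV[R]_n) :
  A^T *m (A *m (left_pinv A *m y)) = A^T *m y.
Proof.
have AA1 : invmx (A^T *m A) *m A^T *m A = 1%:M by exact: left_pinvK.
have AAu : A^T *m A \in unitmx.
  by apply: (@mulmx1_unit _ _ _ _ _).2; rewrite -[RHS]AA1 mulmxA.
by rewrite !mulmxA mulmxV // mul1mx.
Qed.

Lemma normal_equation_sol (u : 'cV[R]_m) (y : 'cV[R]_n) :
  A^T *m (A *m u - y) = 0 -> u = left_pinv A *m y.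
Proof.
move=> /(congr1 (mulmx (invmx (A^T *m A)))).
rewrite mulmx0 !mulmxBr !mulmxA -mulmxA => /eqP; rewrite subr_eq0 => /eqP.
by rewrite -mulmxA mulmxA -/(left_pinv A) => <-; rewrite left_pinvKv.
Qed.

Lemma cost_pinv (u : 'cV[R]_m) (y : 'cV[R]_n) :
  cost (A *m u) y = cost (A *m u) (A *m (left_pinv A *m y)) +
                    cost (A *m (left_pinv A *m y)) y.
Proof.
set w := left_pinv A *m y; rewrite /cost.
rewrite (_ : A *m u - y = A *m (u - w) + (A *m w - y)); last first.
  by rewrite mulmxBr addrA subrK.
rewrite -mulmxBr.
(* The cross term of the expansion vanishes because [A^T] kills the residual. *)
have r0 : A^T *m (A *m w - y) = 0 by rewrite mulmxBr normal_equation subrr.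
move: (A *m w - y) r0 => r r0.
rewrite !(dotpDl, dotpDr) (dotpC r) (dotp_mulmxl A (u - w) r) r0.
have dotp0 k (x : 'cV[R]_k) : dotp x 0 = 0 by rewrite -(scale0r 0) dotpZr mul0r.
by rewrite dotp0 addr0 add0r.
Qed.

End PseudoInverse.
End Algebra.

(** * Borel sets and supports in Euclidean space *)

Section MatrixTopology.
Context {R : realType}.

Lemma entrywise_continuous (T : topologicalType) m n (f : T -> 'M[R]_(m, n)) :
  (forall i j, continuous (fun x => f x i j)) -> continuous f.
Proof.
move=> cf u P [Q Qu QP].
have Q_near (ij : 'I_m * 'I_n) : \forall v \near u, Q ij.1 ij.2 (f v ij.1 ij.2).
  by apply: cf; exact: Qu.
have := filter_forall (nbhs_filter u) Q_near.
by apply: filterS => v Qv; apply: QP => i j; exact: (Qv (i, j)).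
Qed.

Lemma trmx_continuous m n : continuous (@trmx R m n).
Proof.
apply: entrywise_continuous => i j.
rewrite (_ : (fun _ => _) = fun x : 'M[R]_(m, n) => x j i).
  exact: coord_continuous.
by apply/funext => x; rewrite mxE.
Qed.

Lemma mx_norm_tr m n (x : 'M[R]_(m, n)) : `|x^T| = `|x|.
Proof.
suff le_tr k l (y : 'M[R]_(k, l)) : `|y^T| <= `|y|.
  by apply: le_anti; rewrite le_tr -{1}[x]trmxK le_tr.
rewrite {1}/Num.norm /= mx_normrE; apply: bigmax_le => //= -[i j] _ /=.
rewrite mxE [leRHS]/Num.norm /= mx_normrE.
by apply: (le_bigmax _ (fun ij => `|y ij.1 ij.2|) (j, i)).
Qed.

Lemma ler_coord_norm m n (x : 'M[R]_(m, n)) i j : `|x i j| <= `|x|.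
Proof.
rewrite [leRHS]/Num.norm /= mx_normrE.
by apply: (le_bigmax _ (fun ij => `|x ij.1 ij.2|) (i, j)).
Qed.

Lemma mx_norm_mulmx m n (M : 'M[R]_(m, n)) (w : 'cV[R]_n) :
  `|M *m w| <= n%:R * `|M| * `|w|.
Proof.
rewrite {1}/Num.norm /= mx_normrE; apply: bigmax_le; first by rewrite !mulr_ge0.
move=> [i j] _ /=; rewrite mxE; apply: (le_trans (ler_norm_sum _ _ _)).
rewrite -mulrA -[n in n%:R]card_ord mulr_natl -sumr_const; apply: ler_sum => k _.
by rewrite normrM ler_pM // ler_coord_norm.
Qed.

Lemma dotp_le_norm n (w : 'cV[R]_n) : dotp w w <= n%:R * `|w| ^+ 2.
Proof.
rewrite -[n in n%:R]card_ord mulr_natl -sumr_const; apply: ler_sum => k _.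
by rewrite -expr2 -[leLHS]real_normK ?num_real // ler_pXn2r ?nnegrE ?ler_coord_norm.
Qed.

(** Heine-Borel for row vectors is carried over to columns by transposition, which is continuous and
    preserves the norm. *)
Lemma bounded_closed_compact_cV n (K : set 'cV[R]_n) :
  bounded_set K -> closed K -> compact K.
Proof.
move=> bK cK.
have -> : K = trmx @` (trmx @^-1` K : set 'rV[R]_n).
  apply/seteqP; split => [x Kx|_ [x Kx <-]//].
  by exists x^T; rewrite /= trmxK.
apply: continuous_compact.
  by apply: continuous_subspaceT => x; exact: trmx_continuous.
apply: bounded_closed_compact.
  case: bK => M [Mr MK]; exists M; split => // e Me x /= Kx.
  by rewrite -mx_norm_tr; exact: MK.
by apply: preimage_closed => // x _; exact: trmx_continuous.
Qed.

Lemma open_measurable_mx m n (O : set 'M[R]_(m, n)) : open O -> measurable O.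
Proof. exact: sub_sigma_algebra. Qed.

Lemma closed_measurable_mx m n (F : set 'M[R]_(m, n)) : closed F -> measurable F.
Proof.
by move=> /closed_openC /open_measurable_mx /measurableC; rewrite setCK.
Qed.

Lemma continuous_measurable_mx m n (f : 'M[R]_(m, n) -> R) :
  continuous f -> measurable_fun setT f.
Proof.
move=> cf; apply: (measurability _ (measurable_realfun.RGenOpens.measurableE R)).
move=> _ [_ [a [b ->] <-]]; rewrite setTI; apply: open_measurable_mx.
by apply: open_comp; [move=> ? _; exact: cf|exact: interval_open].
Qed.

(** Meant for infima of continuous functions, whose strict sublevel sets are open. *)
Lemma usc_measurable_mx m n (f : 'M[R]_(m, n) -> \bar R) :
  (forall r : R, open [set x | (f x < r%:E)%E]) -> measurable_fun setT f.
Proof.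
move=> uf; apply: (measurability _ (measurable_realfun.ErealGenInftyO.measurableE R)).
move=> _ [_ [a ->] <-]; rewrite setTI; apply: open_measurable_mx.
rewrite (_ : _ @^-1` _ = [set x | (f x < a%:E)%E]) //.
Qed.

Lemma cost_continuousl n (y : 'cV[R]_n) : continuous (fun x => cost x y).
Proof.
move=> x; apply: cvg_big => [||i _]; [exact: add_continuous|exact: nbhs_filter|].
have h : (fun z : 'cV[R]_n => (z - y) i 0) = fun z => z i 0 - y i 0.
  by apply/funext => z; rewrite !mxE.
have c : (z - y) i 0 @[z --> x] --> (x - y) i 0.
  rewrite h !mxE; apply: (@cvgB _ _ _ (nbhs x)); last exact: cvg_cst.
  exact: (@coord_continuous R n 1 i 0 x).
exact: (cvgM c c).
Qed.

Lemma cost_continuousr n (x : 'cV[R]_n) : continuous (cost x).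
Proof.
rewrite (_ : cost x = fun y => cost y x); first exact: cost_continuousl.
by apply/funext => y; exact: costC.
Qed.

End MatrixTopology.

Section Support.
Context {R : realType} {n : nat}.
Implicit Types mu : probability 'cV[R]_n R.
Local Open Scope ereal_scope.

Lemma msupport_closed mu : closed (msupport mu).
Proof.
rewrite -openC openE => x /=.
rewrite /msupport /= => /existsNP [V] /not_implyP [oV] /not_implyP [Vx muV].
apply: (filterS _ (open_nbhs_nbhs (conj oV Vx))) => y Vy /(_ V oV Vy).
exact: muV.
Qed.

(** The complement of the support is exhausted by the compact sets [C k] of points of norm at most k
    and at distance at least 1/(k+1) from the support. Each is covered by finitely many open null
    sets. *)
Lemma msupport_compl0 mu : mu (~` msupport mu) = 0.
Proof.
pose F := msupport mu.
pose C k := [set x : 'cV[R]_n | (`|x| <= k%:R)%R /\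
                        forall w, F w -> (k.+1%:R^-1 <= `|x - w|)%R].
have cC k : compact (C k).
  apply: bounded_closed_compact_cV.
    exists k%:R; split => // M kM x [xk _]; exact: le_trans xk (ltW kM).
  rewrite (_ : C k = ((@Num.norm _ 'cV[R]_n) @^-1` [set r | r <= k%:R])%R `&`
     \bigcap_(w in F) ((fun x => `|x - w|) @^-1` [set r | k.+1%:R^-1 <= r])%R) //.
  apply: closedI.
    apply: preimage_closed; last exact: closed_le.
    by move=> x _; exact: norm_continuous.
  apply: closed_bigI => w _.
  apply: preimage_closed; last exact: closed_ge.
  move=> x _; apply: (@cvg_norm _ _ _ (nbhs x)); apply: (@cvgB _ _ _ (nbhs x)).
    exact: cvg_id.
  exact: cvg_cst.
have CF k : C k `<=` ~` F.
  move=> x [_ h] Fx; have := h _ Fx; rewrite subrr normr0.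
  by rewrite leNgt invr_gt0 ltr0n.
have mC k : measurable (C k).
  apply: closed_measurable_mx; apply: compact_closed (cC k).
  exact: norm_hausdorff.
have muC k : mu (C k) = 0.
  have := cC k; rewrite compact_cover.
  move=> /(_ (set 'cV[R]_n) [set V | open V /\ mu V = 0] id) [].
  - by move=> V [].
  - move=> x /CF; rewrite /F /msupport /=.
    move=> /existsNP [V] /not_implyP [oV] /not_implyP [Vx muV].
    exists V => //; split => //; apply/eqP.
    by rewrite eq_le measure_ge0 andbT leNgt; exact/negP.
  move=> D DV CD; apply/(negligibleP mu (mC k)).
  (* The finite subcover becomes a sequence padded with empty sets, to which the countable union of
     null sets applies. *)
  apply: (@negligibleS _ _ _ mu (\bigcup_j nth set0 (finmap.enum_fset D) j)).
    move=> x /CD [V /= DV' Vx]; exists (index V (finmap.enum_fset D)) => //.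
    by rewrite nth_index.
  apply: negligible_bigcup => j.
  have [jD|jD] := ltnP j (size (finmap.enum_fset D)); last first.
    by rewrite nth_default //; exact: negligible_set0.
  have /DV := mem_nth set0 jD => /set_mem [oV muV].
  by apply/negligibleP => //; exact: open_measurable_mx.
have -> : ~` msupport mu = \bigcup_k C k.
  apply/seteqP; split => [x Fx|x [k _ /CF]//].
  have oF : open (~` F) by rewrite openC; exact: msupport_closed.
  have /nbhs_ballP [e /= e0 eF] := open_nbhs_nbhs (conj oF Fx).
  (* The first bound gives |x| <= k, the second 1/(k+1) < e. *)
  pose k := maxn (Num.truncn `|x|%R).+1 (Num.truncn e^-1%R).
  exists k => //; split.
    apply: le_trans (ltW (truncnS_gt _)) _; rewrite ler_nat; exact: leq_maxl.
  move=> w Fw; rewrite leNgt; apply/negP => xw.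
  apply: (eF w) => //; rewrite -ball_normE /=; apply: lt_trans xw _.
  rewrite -[e]invrK ltf_pV2 ?posrE ?invr_gt0 //.
  apply: lt_le_trans (truncnS_gt _) _; rewrite ler_nat ltnS; exact: leq_maxr.
apply/negligibleP; first by apply: bigcup_measurable => k _; exact: mC.
by apply: negligible_bigcup => k; apply/(negligibleP mu (mC k)); exact: muC.
Qed.

Lemma msupport_sub_closed mu (F : set 'cV[R]_n) :
  closed F -> mu (~` F) = 0 -> msupport mu `<=` F.
Proof.
move=> cF muF x sx; apply: contrapT => Fx.
by have := sx (~` F) (closed_openC cF) Fx; rewrite muF ltxx.
Qed.

End Support.

(** * Integration and weak duality *)

Section Integration.
Context {R : realType}.
Local Open Scope ereal_scope.

(** Agreement is asked on measurable sets only, which is what the marginal conditions of [coupling]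
    provide. *)
Lemma change_of_variables d1 d2 (X : measurableType d1) (Y : measurableType d2)
    (phi : X -> Y) (gamma : {measure set X -> \bar R})
    (mu : {measure set Y -> \bar R}) (f : Y -> \bar R) :
  measurable_fun setT phi ->
  (forall B, measurable B -> gamma (phi @^-1` B) = mu B) ->
  mu.-integrable setT f ->
  gamma.-integrable setT (f \o phi) /\ \int[mu]_y f y = \int[gamma]_x f (phi x).
Proof.
move=> mphi gmu intf; have mf := measurable_int _ intf.
have pushE (g : Y -> \bar R) :
    \int[mu]_y g y = \int[pushforward gamma phi]_y g y.
  apply: (@eq_measure_integral _ _ _ _ (pushforward gamma phi)) => //.
  by move=> B mB _; rewrite -gmu.
have intfphi : gamma.-integrable setT (f \o phi).
  apply/integrableP; split; first exact: measurableT_comp.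
  have /integrableP[_] := intf; rewrite pushE (ge0_integral_pushforward mphi) //.
  exact: measurableT_comp.
split => //; rewrite pushE (integral_pushforward mphi) //.
Qed.

Lemma integral_eq_conull d (X : measurableType d) (mu : {measure set X -> \bar R})
    (T : set X) (f g : X -> \bar R) :
  measurable T -> mu (~` T) = 0 -> (forall x, T x -> g x = f x) ->
  measurable_fun setT g -> mu.-integrable setT f ->
  mu.-integrable setT g /\ \int[mu]_x g x = \int[mu]_x f x.
Proof.
move=> mT muT fg mg intf.
have mCT : measurable (~` T) by exact: measurableC.
have TE : setT `\` ~` T = T by rewrite setTD setCK.
have intfT : mu.-integrable T f by apply: integrableS intf.
have intg : mu.-integrable setT g.
  apply/(negligible_integrable mCT) => //; rewrite TE.
  by apply: eq_integrable intfT => // x /[!inE] /fg.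
split => //; rewrite (negligible_integral mCT) // TE.
rewrite [RHS](negligible_integral mCT) // TE.
by apply: eq_integral => x /[!inE] /fg.
Qed.

Lemma measurable_mem d (X : measurableType d) (T : set X) :
  measurable T -> measurable_fun setT (fun x => x \in T).
Proof.
move=> mT.
have mT1 : measurable (setT `&` (mem T : _ -> bool) @^-1` [set true]).
  by rewrite setTI preimage_mem_true.
exact: (measurable_fun_bool true mT1).
Qed.

Lemma bounded_conull_integrable d (X : measurableType d)
    (mu : probability X R) (T : set X) (f : X -> R) (M : R) :
  measurable T -> mu (~` T) = 0 -> (forall x, T x -> (`|f x| <= M)%R) ->
  measurable_fun setT f -> mu.-integrable setT (EFin \o f).
Proof.
move=> mT muT fM mf.
have mCT : measurable (~` T) by exact: measurableC.
apply/(negligible_integrable mCT) => //; first exact/measurable_EFinP.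
rewrite setTD setCK; apply: measurable_bounded_integrable => //.
- by apply: (le_lt_trans (probability_le1 _ _)) => //; rewrite ltry.
- exact: measurable_funS mf.
- exists M; split => [|K MK x Tx]; first exact: num_real.
  exact: le_trans (fM x Tx) (ltW MK).
Qed.

Context {n : nat}.
Implicit Types mu nu : probability 'cV[R]_n R.

Lemma measurable_cost d (X : measurableType d) (f g : X -> 'cV[R]_n) :
  measurable_fun setT f -> measurable_fun setT g ->
  measurable_fun setT (fun x => cost (f x) (g x)).
Proof.
move=> mf mg; rewrite (_ : (fun _ => _) =
  fun x => (\sum_(i < n) (f x i 0 - g x i 0) * (f x i 0 - g x i 0))%R); last first.
  by apply/funext => x; apply: eq_bigr => i _; rewrite !mxE.
have mcoord (h : X -> 'cV[R]_n) i : measurable_fun setT h ->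
    measurable_fun setT (fun x => h x i 0%R).
  move=> mh; apply: (@measurableT_comp _ _ _ _ _ _ (fun v : 'cV[R]_n => v i 0%R)) => //.
  apply: continuous_measurable_mx; exact: coord_continuous.
apply: measurable_sum => i; apply: measurable_funM;
  by apply: measurable_funB; exact: mcoord.
Qed.

Lemma measurable_transport_cost :
  measurable_fun setT (fun z : 'cV[R]_n * 'cV[R]_n => (cost z.1 z.2)%:E).
Proof.
apply/measurable_EFinP.
by apply: measurable_cost; [exact: measurable_fst|exact: measurable_snd].
Qed.

Lemma weak_duality mu nu phi psi gamma :
  dual_admissible mu nu phi psi -> coupling mu nu gamma ->
  dual_value mu nu phi psi <= \int[gamma]_z (cost z.1 z.2)%:E.
Proof.
move=> [iphi ipsi le_cost] [gmu gnu].
have [iphi' Ephi] := change_of_variables measurable_fst gmu iphi.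
have [ipsi' Epsi] := change_of_variables measurable_snd gnu ipsi.
rewrite /dual_value Ephi Epsi -integralD //.
have mcost := measurable_transport_cost.
(* An infinite cost makes the bound trivial; a finite one makes the nonnegative cost integrable, as
   the comparison of integrals requires. *)
have [cfin|] := ltP (\int[gamma]_z (cost z.1 z.2)%:E) +oo; last first.
  by rewrite leye_eq => /eqP ->; exact: leey.
apply: le_integral => //.
- exact: integrableD.
- apply/integrableP; split => //.
  apply: le_lt_trans cfin; apply: ge0_le_integral => //.
  + exact: measurableT_comp.
  + by move=> z _; rewrite gee0_abs // lee_fin; exact: cost_ge0.
Qed.

End Integration.

(** * Dual pairs written on the parameter space *)

Section DualPairs.
Context {R : realType} {m n : nat} (A : 'M[R]_(n, m)).
Hypothesis rankA : \rank A = m.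
Local Notation B := (left_pinv A).
Local Open Scope ereal_scope.

(** The points fixed by A B form the range of A, here seen as the zero set of a continuous linear
    map. *)
Lemma range_closed : closed [set x : 'cV[R]_n | A *m (B *m x) = x].
Proof.
rewrite (_ : [set x | _] = (mulmx (A *m B - 1%:M)) @^-1` [set 0%R : 'cV[R]_n]).
  apply: preimage_closed; first by move=> x _; exact: continuous_mulmx.
  exact: (accessible_closed_set1 (hausdorff_accessible (@norm_hausdorff _ _))).
apply/seteqP; split => x /=; rewrite mulmxBl mul1mx -(mulmxA A).
  by move=> ->; rewrite subrr.
by move=> /eqP; rewrite subr_eq0 => /eqP.
Qed.

(* A pair (g, psi) in the variables (u, y) becomes a dual pair after extending
   g by -oo outside A(T), a set of full measure for the push-forward of rho. *)
Lemma dual_extension (rho : probability 'cV[R]_m R) (nu : probability 'cV[R]_n R)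
    (T : set 'cV[R]_m) (g : 'cV[R]_m -> R) (psi : 'cV[R]_n -> R) :
  measurable T -> rho (~` T) = 0 ->
  rho.-integrable setT (EFin \o g) -> nu.-integrable setT (EFin \o psi) ->
  (forall u y, T u -> (g u + psi y <= cost (A *m u) y)%R) ->
  exists2 phi, dual_admissible (push A rho) nu phi (EFin \o psi) &
    dual_value (push A rho) nu phi (EFin \o psi) =
    \int[rho]_u (g u)%:E + \int[nu]_y (psi y)%:E.
Proof.
move=> mT rhoT ig ipsi gpsi.
(* [K] is the image A(T), described through B so that its measurability is visible. *)
pose K := [set x : 'cV[R]_n | A *m (B *m x) = x] `&` mulmx B @^-1` T.
have mK : measurable K.
  apply: measurableI; first exact: closed_measurable_mx range_closed.
  by rewrite -[X in measurable X]setTI; exact: measurable_mulmx.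
pose phi (x : 'cV[R]_n) : \bar R := if x \in K then (g (B *m x))%:E else -oo.
have mg : measurable_fun setT (EFin \o g) := measurable_int _ ig.
have mphi : measurable_fun setT phi.
  have mgB : measurable_fun setT (fun x : 'cV[R]_n => (g (B *m x))%:E).
    exact: (measurableT_comp mg (@measurable_mulmx R m n 1 B)).
  exact: (measurable_fun_ifT (measurable_mem mK) mgB (measurable_cst _)).
have phiA u : T u -> phi (A *m u) = (g u)%:E.
  by move=> Tu; rewrite /phi mem_set /K /= left_pinvKv.
have mphiA : measurable_fun setT (phi \o mulmx A).
  exact: (measurableT_comp mphi (@measurable_mulmx R n m 1 A)).
have [iphiA EphiA] := integral_eq_conull mT rhoT phiA mphiA ig.
exists phi.
  split=> //.
    exact: (integrable_pushforward (@measurable_mulmx R n m 1 A)).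
  move=> x y; rewrite /phi; case: ifPn => [/set_mem [xE Tx]|_] /=.
    by rewrite -EFinD lee_fin -[x in cost x]xE; exact: gpsi.
  by rewrite addNye leNye.
rewrite /dual_value; congr (_ + _); rewrite -EphiA.
exact: (integral_pushforward (@measurable_mulmx R n m 1 A)).
Qed.

End DualPairs.

(** * Distance functions and separation of measures *)

Section Separation.
Context {R : realType} {V : normedModType R} (F : set V).

(** For empty [F] this is 0, the default value of [inf]. *)
Definition dist_set (u : V) : R := inf [set `|u - w| | w in F].

Lemma dist_set_has_lbound u : has_lbound [set `|u - w| | w in F].
Proof. by exists 0 => _ [w _ <-]; exact: normr_ge0. Qed.

Lemma dist_set_ge0 u : 0 <= dist_set u.
Proof.
rewrite /dist_set; have [[w Fw]|F0] := pselect (F !=set0).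
  apply: lb_le_inf; first by exists `|u - w|, w.
  by move=> _ [w' _ <-]; exact: normr_ge0.
have -> : F = set0 by apply: contrapT => /eqP /set0P.
by rewrite image_set0 inf0.
Qed.

Lemma dist_set_le u w : F w -> dist_set u <= `|u - w|.
Proof. by move=> Fw; apply: ge_inf; [exact: dist_set_has_lbound|exists w]. Qed.

Lemma dist_set_in u : F u -> dist_set u = 0.
Proof.
move=> Fu; apply/eqP; rewrite eq_le dist_set_ge0 andbT.
by rewrite (le_trans (dist_set_le u Fu)) // subrr normr0.
Qed.

Lemma dist_set_gt0 u : F !=set0 -> closed F -> ~ F u -> 0 < dist_set u.
Proof.
move=> [w0 Fw0] cF Fu.
have /nbhs_ballP [e /= e0 eF] := open_nbhs_nbhs (conj (closed_openC cF) Fu).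
apply: (lt_le_trans e0); apply: lb_le_inf; first by exists `|u - w0|, w0.
move=> _ [w Fw <-]; rewrite leNgt; apply/negP => uw.
by apply: (eF w) => //; rewrite -ball_normE.
Qed.

Lemma dist_set_lipschitz u v : `|dist_set u - dist_set v| <= `|u - v|.
Proof.
have [[w0 Fw0]|F0] := pselect (F !=set0); last first.
  have E0 : F = set0 by apply: contrapT => /eqP /set0P.
  by rewrite /dist_set E0 !image_set0 inf0 subrr normr0.
suff le_dist a b : dist_set a - dist_set b <= `|a - b|.
  by rewrite ler_norml le_dist andbT lerNl opprB distrC le_dist.
rewrite lerBlDr -lerBlDl; apply: lb_le_inf; first by exists `|b - w0|, w0.
move=> _ [w Fw <-]; rewrite lerBlDl; apply: le_trans (dist_set_le a Fw) _.
by rewrite -(subrKA b a); exact: ler_normD.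
Qed.

End Separation.

Lemma lipschitz_fun_continuous (R : realType) (V : normedModType R) (h : V -> R)
    (L : R) : (forall u v, `|h u - h v| <= L * `|u - v|) -> continuous h.
Proof.
move=> hL u; apply/cvgrPdist_le => e e0; near=> v.
apply: (le_trans (hL u v)).
have L1 : 0 < `|L| + 1 by rewrite ltr_wpDl.
apply: (@le_trans _ _ ((`|L| + 1) * `|u - v|)).
  by rewrite ler_wpM2r // (le_trans (ler_norm L)) // lerDl.
rewrite mulrC -ler_pdivlMr //; near: v.
by apply: cvgr_dist_le; [exact: cvg_id|exact: divr_gt0].
Unshelve. all: by end_near. Qed.

(** For open O with complement F, the Lipschitz functions min(1, k d(u, F)) increase to the
    indicator of O, so the measures agree on open sets, a generating family closed under
    intersection. *)
Lemma eq_prob_lipschitz (R : realType) (m : nat)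
    (mu nu : probability 'cV[R]_m R) :
  (forall (h : 'cV[R]_m -> R) (L : R), (forall u, 0 <= h u <= 1) ->
     (forall u v, `|h u - h v| <= L * `|u - v|) ->
     (\int[mu]_u (h u)%:E = \int[nu]_u (h u)%:E)%E) ->
  eq_prob mu nu.
Proof.
move=> int_eq.
have open_eq O : open O -> mu O = nu O.
  (* The whole space is treated apart: the distance to its empty complement is 0 by convention, and
     the approximation would fail. *)
  move=> oO; have [[w0 Fw0]|F0] := pselect ((~` O) !=set0); last first.
    rewrite (_ : O = setT) ?probability_setT //.
    by apply/seteqP; split => // x _; apply: contrapT => Ox; apply: F0; exists x.
  have cF : closed (~` O) by exact: open_closedC.
  pose d := dist_set (~` O).
  pose h (k : nat) u := Num.min 1 (k%:R * d u).
  have h01 k u : 0 <= h k u <= 1.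
    by rewrite /h le_min ler01 mulr_ge0 ?dist_set_ge0 //= ge_min lexx.
  have hL k u v : `|h k u - h k v| <= k%:R * `|u - v|.
    apply: (@le_trans _ _ `|k%:R * d u - k%:R * d v|); last first.
      by rewrite -mulrBr normrM ger0_norm // ler_wpM2l // dist_set_lipschitz.
    rewrite /h; move: (k%:R * d u) (k%:R * d v) => a b; rewrite /Num.min.
    have abl := ler_norm (a - b); have abr := ler_norm (b - a).
    rewrite distrC in abr; rewrite ler_norml.
    by case: ltP => ha; case: ltP => hb; apply/andP; split; lra.
  have intE (P : probability 'cV[R]_m R) :
      (\int[P]_u (h k u)%:E)%E @[k --> \oo] --> P O.
    rewrite (_ : P O = (\int[P]_u limn (fun k => (h k u)%:E))%E); last first.
      have mO : measurable O by exact: open_measurable_mx.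
      rewrite -[X in P X = _]setIT -integral_indic //; apply: eq_integral => u _.
      apply/esym/cvg_lim => //; rewrite indicE.
      have [/set_mem Ou|/negP nOu] := boolP (u \in O); last first.
        have Fu : (~` O) u by move=> Ou; apply: nOu; exact/mem_set.
        rewrite (_ : (fun _ => _) = cst 0%:E); first exact: cvg_cst.
        apply/funext => k; rewrite /h /d dist_set_in // mulr0.
        by rewrite (min_idPr _).
      have d0 : 0 < d u.
        exact: (dist_set_gt0 (ex_intro _ w0 Fw0) cF (fun Fu => Fu Ou)).
      apply: cvg_near_cst; near=> k; congr EFin; apply/min_idPl.
      rewrite -ler_pdivrMr //; near: k; exact: nbhs_infty_ger.
    apply: cvg_monotone_convergence => //.
    - move=> k; apply/measurable_EFinP; apply: continuous_measurable_mx.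
      exact: lipschitz_fun_continuous (hL k).
    - by move=> k u _; rewrite lee_fin; have /andP[] := h01 k u.
    - move=> u _ j k jk; rewrite lee_fin /h le_min !ge_min lexx /=.
      by apply/orP; right; rewrite ler_wpM2r ?dist_set_ge0 // ler_nat.
  have intnu : (\int[nu]_u (h k u)%:E)%E @[k --> \oo] --> mu O.
    rewrite (_ : (fun k => _) = fun k => (\int[mu]_u (h k u)%:E)%E) //.
    by apply/funext => k; rewrite (int_eq _ _ (h01 k) (hL k)).
  exact: (cvg_unique _ intnu (intE nu)).
move=> B mB; apply: (measure_unique (@open 'cV[R]_m) (fun=> setT)) => //.
- exact: openI.
- by move=> _; exact: openT.
- by rewrite bigcup_const.
- by move=> k; rewrite (le_lt_trans (probability_le1 _ _)) ?ltry.
Unshelve. all: by end_near. Qed.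

(** * Minimizers *)

Section CompactSupport.
Context {R : realType} {n : nat}.

Lemma compact_fun_bounded (T : topologicalType) (S : set T) (f : T -> R) :
  compact S -> {within S, continuous f} ->
  exists M, forall y, S y -> `|f y| <= M.
Proof.
move=> cS cf; have := compact_bounded (continuous_compact cf cS).
move=> [M [_ MS]]; exists (M + 1) => y Sy.
by apply: (MS (M + 1)); [rewrite ltrDl|exists y].
Qed.

Lemma continuous_integrable (nu : probability 'cV[R]_n R) (f : 'cV[R]_n -> R) :
  compact (msupport nu) -> continuous f -> nu.-integrable setT (EFin \o f).
Proof.
move=> cS cf; have [M fM] := compact_fun_bounded cS (continuous_subspaceT cf).
apply: (bounded_conull_integrable _ (msupport_compl0 nu) fM).
  exact: closed_measurable_mx (@msupport_closed _ _ nu).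
exact: continuous_measurable_mx.
Qed.

End CompactSupport.

Section Minimizer.
Context {R : realType} {m n : nat} (A : 'M[R]_(n, m)).
Hypothesis rankA : \rank A = m.
Variable nu : probability 'cV[R]_n R.
Hypothesis compact_supp : compact (msupport nu).
Local Notation B := (left_pinv A).

(** The squared Euclidean distance from y to the range of A. *)
Definition gap (y : 'cV[R]_n) : R := cost (A *m (B *m y)) y.

Lemma cost_gap u y : cost (A *m u) y = cost (A *m u) (A *m (B *m y)) + gap y.
Proof. exact: cost_pinv. Qed.

Lemma gap_continuous : continuous gap.
Proof.
rewrite (_ : gap = fun y => cost ((A *m B - 1%:M) *m y) 0).
  move=> y; exact: (continuous_comp (@continuous_mulmx R n n 1 (A *m B - 1%:M) y)
    (@cost_continuousl R n 0 _)).
apply/funext => y; rewrite /gap /cost subr0 mulmxBl mul1mx mulmxA.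
by rewrite (mulmxA A).
Qed.

Lemma gap_integrable : nu.-integrable setT (EFin \o gap).
Proof. by apply: continuous_integrable => //; exact: gap_continuous. Qed.

Local Notation gapE := (\int[nu]_y (gap y)%:E)%E.

(** Since w = B A w, the norm of w is controlled by that of A w. This links the sup norm, used for
    Lipschitz bounds, to the Euclidean cost. *)
Lemma mx_norm_cost_le : exists2 D, 0 <= D &
  forall u v : 'cV[R]_m, `|u - v| ^+ 2 <= D * cost (A *m u) (A *m v).
Proof.
exists ((n%:R * `|B|) ^+ 2) => [|u v]; first exact: sqr_ge0.
rewrite /cost -mulmxBr; move: (u - v) => {u v} w.
have le_dotp : `|A *m w| <= Num.sqrt (dotp (A *m w) (A *m w)).
  rewrite {1}/Num.norm /= mx_normrE; apply: bigmax_le; first exact: sqrtr_ge0.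
  move=> [i j] _ /=; rewrite -sqrtr_sqr ler_wsqrtr // ord1 /dotp (bigD1 i) //=.
  by rewrite -expr2 lerDl sumr_ge0 // => k _; rewrite -expr2 sqr_ge0.
rewrite -(sqr_sqrtr (dotp_ge0 (A *m w))) -exprMn.
rewrite ler_pXn2r // ?nnegrE ?mulr_ge0 ?sqrtr_ge0 //.
apply: (@le_trans _ _ (n%:R * `|B| * `|A *m w|)); last by rewrite ler_wpM2l // mulr_ge0.
rewrite -{1}[w](left_pinvKv rankA); move: (A *m w) => {le_dotp w} w.
exact: mx_norm_mulmx.
Qed.

Local Notation projection := (push B nu).

(** The coupling is the law under nu of the pair (A B y, y). *)
Lemma projection_coupling : exists2 gamma,
  coupling (push A projection) nu gamma &
  (\int[gamma]_z (cost z.1 z.2)%:E = gapE)%E.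
Proof.
have mX : measurable_fun setT (fun y : 'cV[R]_n => (A *m (B *m y), y)).
  apply: measurable_fun_pair; last exact: measurable_id.
  exact: measurableT_comp (@measurable_mulmx R n m 1 A) (@measurable_mulmx R m n 1 B).
pose X : {mfun 'cV[R]_n >-> ('cV[R]_n * 'cV[R]_n)%type} := mfun_Sub (mem_set mX).
exists (distribution nu X) => //.
rewrite (ge0_integral_pushforward mX nu measurableT measurable_transport_cost) //.
by move=> z _; rewrite lee_fin; exact: cost_ge0.
Qed.

(** Weak duality for the pair (0, gap), admissible by Pythagoras. *)
Lemma gap_le_cost (rho : probability 'cV[R]_m R) gamma :
  coupling (push A rho) nu gamma ->
  (gapE <= \int[gamma]_z (cost z.1 z.2)%:E)%E.
Proof.
move=> cgamma.
have rho0 : rho (~` setT) = 0%E by rewrite setCT measure0.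
have int0 : rho.-integrable setT (EFin \o (fun=> 0)) by exact: integrable0.
have le_cost u y : [set: 'cV[R]_m] u -> 0 + gap y <= cost (A *m u) y.
  by move=> _; rewrite add0r cost_gap lerDr cost_ge0.
have [phi adm dualE] :=
  dual_extension rankA measurableT rho0 int0 gap_integrable le_cost.
rewrite integral0 add0e in dualE.
by rewrite -dualE; exact: weak_duality.
Qed.

(** The pair (0, gap) is perturbed at first order in s, while admissibility is restored at a price
    of order s^2; the first-order term must therefore vanish. *)
Lemma saturated_eq_projection (rho : probability 'cV[R]_m R) :
  (forall phi psi, dual_admissible (push A rho) nu phi psi ->
     (dual_value (push A rho) nu phi psi <= gapE)%E) ->
  eq_prob rho projection.
Proof.
move=> dual_le; apply: eq_prob_lipschitz => h L h01 hL.
have [D D0 normD] := mx_norm_cost_le.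
have ch : continuous h := lipschitz_fun_continuous hL.
have mh : measurable_fun setT h := continuous_measurable_mx ch.
have h1 u : setT u -> `|h u| <= 1.
  by move=> _; have /andP[h0 ?] := h01 u; rewrite ger0_norm.
have ih (P : probability 'cV[R]_m R) : P.-integrable setT (EFin \o h).
  apply: (bounded_conull_integrable measurableT _ h1 mh).
  by rewrite setCT measure0.
have ihB : nu.-integrable setT (EFin \o (fun y => h (B *m y))).
  apply: continuous_integrable => // y.
  exact: (continuous_comp (@continuous_mulmx R m n 1 B y) (ch _)).
have -> : (\int[projection]_u (h u)%:E = \int[nu]_y (h (B *m y))%:E)%E.
  rewrite (integral_pushforward (@measurable_mulmx R m n 1 B)) //.
  exact/measurable_EFinP.
(* With K = L^2 D one has (h u - h (B y))^2 <= K c, where c is the cost between A u and A B y; C = K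
   / 4 is what completing the square in s then needs. *)
pose C := L ^+ 2 * D / 4.
have C0 : 0 <= C.
  by apply: divr_ge0 => //; apply: mulr_ge0 => //; exact: sqr_ge0.
set a := (X in X = _); set b := (X in _ = X).
have fa : a \is a fin_num := integrable_fin_num measurableT (ih rho).
have fb : b \is a fin_num := integrable_fin_num measurableT ihB.
have fG : gapE \is a fin_num := integrable_fin_num measurableT gap_integrable.
suff key s : s * (fine a - fine b) <= s ^+ 2 * C.
  rewrite -(fineK fa) -(fineK fb); congr EFin; apply/eqP; rewrite -subr_eq0.
  move: (fine a - fine b) key => d key.
  (* For this s the bound reads d^2 (C + 1) <= d^2 C, so d = 0; the added 1 keeps the denominator
     positive when C = 0. *)
  have := key (d / (C + 1)); have C1 : 0 < C + 1 by rewrite ltr_wpDl.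
  rewrite expr_div_n mulrAC -(ler_pM2r (exprn_gt0 2 C1)).
  have C10 := lt0r_neq0 C1.
  rewrite [X in X <= _](_ : _ = d ^+ 2 * (C + 1)); last by field.
  rewrite [X in _ <= X](_ : _ = d ^+ 2 * C); last by field.
  rewrite mulrDr mulr1 gerDl => d2.
  by rewrite -sqrf_eq0 eq_le d2 sqr_ge0.
have iZ : nu.-integrable setT (fun y => s%:E * (h (B *m y))%:E)%E.
  exact: (integrableZl measurableT s ihB).
have icst (c : R) : nu.-integrable setT (cst c%:E).
  exact: (finite_measure_integrable_cst nu c measurableT).
have iD : nu.-integrable setT (fun y => s%:E * (h (B *m y))%:E + (s ^+ 2 * C)%:E)%E.
  exact: (integrableD measurableT iZ (icst _)).
have ipsi : nu.-integrable setT
    (EFin \o (fun y => gap y - (s * h (B *m y) + s ^+ 2 * C))).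
  apply: (integrableB measurableT gap_integrable iD).
have ig : rho.-integrable setT (EFin \o (fun u => s * h u)).
  exact: (integrableZl measurableT s (ih rho)).
have rho0 : rho (~` setT) = 0%E by rewrite setCT measure0.
have le_cost u y : [set: 'cV[R]_m] u ->
    s * h u + (gap y - (s * h (B *m y) + s ^+ 2 * C)) <= cost (A *m u) y.
  move=> _; rewrite cost_gap.
  have L2 : (h u - h (B *m y)) ^+ 2 <= L ^+ 2 * `|u - B *m y| ^+ 2.
    rewrite -real_normK ?num_real // -exprMn ler_pXn2r ?nnegrE //.
    exact: le_trans (normr_ge0 _) (hL u (B *m y)).
  have := le_trans L2 (ler_wpM2l (sqr_ge0 L) (normD u (B *m y))).
  have := cost_ge0 (A *m u) (A *m (B *m y)).
  rewrite mulrA; set K := L ^+ 2 * D; set c := cost _ _.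
  have := mulr_ge0 (sqr_ge0 L) D0; rewrite -/K.
  rewrite /C -/K; move: (h u) (h (B *m y)) (gap y) => p q G K0 c0 pq.
  suff le_c : s * (p - q) <= c + s ^+ 2 * (K / 4).
    rewrite -subr_ge0 (_ : _ - _ = c + s ^+ 2 * (K / 4) - s * (p - q)); last by ring.
    by rewrite subr_ge0.
  move: (p - q) pq => d dK.
  (* The inequality is to be multiplied by K, so K = 0, where d = 0, comes first. *)
  have [K0'|Kn0] := eqVneq K 0.
    have /eqP : d ^+ 2 = 0.
      apply/eqP; rewrite eq_le sqr_ge0 andbT.
      by apply: le_trans dK _; rewrite K0' mul0r.
    by rewrite sqrf_eq0 => /eqP ->; rewrite mulr0 K0' mul0r mulr0 addr0.
  have Kp : 0 < K by rewrite lt0r Kn0.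
  rewrite -(ler_pM2l Kp) -subr_ge0.
  have : 0 <= (d - s * K / 2) ^+ 2 + (K * c - d ^+ 2).
    by rewrite addr_ge0 ?sqr_ge0 ?subr_ge0.
  by congr (0 <= _); field.
have [phi adm dualE] := dual_extension rankA measurableT rho0 ig ipsi le_cost.
have := dual_le _ _ adm; rewrite dualE.
have -> : (\int[rho]_u (s * h u)%:E = s%:E * a)%E.
  exact: (integralZl measurableT (ih rho) s).
have -> : (\int[nu]_y (gap y - (s * h (B *m y) + s ^+ 2 * C))%:E =
    gapE - (s%:E * b + (s ^+ 2 * C)%:E))%E.
  rewrite -[LHS]/(\int[nu]_y ((gap y)%:E -
    (s%:E * (h (B *m y))%:E + (s ^+ 2 * C)%:E)))%E.
  rewrite (integralB measurableT gap_integrable iD) (integralD measurableT iZ (icst _)).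
  have nuT : nu setT = 1%E by exact: probability_setT.
  rewrite (integralZl measurableT ihB s) integral_cst //.
  by congr (_ - (_ + _))%E; rewrite -[RHS]mule1; congr (_ * _)%E; exact: nuT.
rewrite -(fineK fa) -(fineK fb) -(fineK fG) -!EFinM -!EFinD lee_fin.
move: (fine a) (fine b) (fine gapE) => x y z.
rewrite -subr_le0 [X in X <= 0](_ : _ = s * (x - y) - s ^+ 2 * C); last by ring.
by rewrite subr_le0.
Qed.

End Minimizer.

Section MinimizerTheorem.
Context {R : realType} {m n : nat} (A : 'M[R]_(n, m)).
Hypothesis rankA : \rank A = m.
Variable nu : probability 'cV[R]_n R.
Hypothesis compact_supp : compact (msupport nu).
Local Notation B := (left_pinv A).
Local Open Scope ereal_scope.

(** The infimum under the square root of [W2]; comparisons are made here, the root being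
    monotone. *)
Definition transport_cost k (mu nu' : probability 'cV[R]_k R) : \bar R :=
  ereal_inf [set \int[gamma]_z (cost z.1 z.2)%:E | gamma in coupling mu nu'].

Lemma transport_cost_ge0 k (mu nu' : probability 'cV[R]_k R) :
  0 <= transport_cost mu nu'.
Proof.
apply: le_ereal_inf_tmp => _ [gamma _ <-]; apply: integral_ge0 => z _.
by rewrite lee_fin; exact: cost_ge0.
Qed.

Lemma transport_cost_projection :
  transport_cost (push A (push B nu)) nu <= \int[nu]_y (gap A y)%:E.
Proof.
have [gamma cgamma <-] := projection_coupling A nu.
by apply: ereal_inf_lbound; exists gamma.
Qed.

Lemma projection_minimizer : W2_minimizer A nu (push B nu).
Proof.
move=> rho; rewrite /W2 lee_sqrt; last exact: transport_cost_ge0.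
apply: (le_trans transport_cost_projection).
by apply: le_ereal_inf_tmp => _ [gamma cgamma <-]; exact: gap_le_cost cgamma.
Qed.

(** A minimizer costs at most as much as the projection, hence at most the integral of [gap]; weak
    duality extends this bound to every dual pair. *)
Lemma minimizer_unique rho :
  W2_minimizer A nu rho -> eq_prob rho (push B nu).
Proof.
move=> /(_ (push B nu)); rewrite /W2 lee_sqrt; last exact: transport_cost_ge0.
move=> le_cost; apply: saturated_eq_projection => // phi psi adm.
apply: le_trans transport_cost_projection; apply: le_trans le_cost.
by apply: le_ereal_inf_tmp => _ [gamma cgamma <-]; exact: weak_duality.
Qed.

End MinimizerTheorem.

(** * First-order calculus at critical points *)

Section Calculus.
Context {R : realType}.

(** A quadratic bound around the single point u makes the increment a little-o, so the differential
    at u is 0. *)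
Lemma quadratic_differentiable (V : normedModType R) (f : V -> R) (u : V) (C : R) :
  (forall v, `|f v - f u| <= C * `|v - u| ^+ 2) ->
  differentiable f u /\ forall v, 'D_v f u = 0.
Proof.
move=> fC.
have [c0 E] : continuous (0 : V -> R) /\
    f \o shift u = cst (f u) + (0 : V -> R) +o_ 0 id.
  split; first exact: cst_continuous.
  apply/eqaddoP => e e0; near=> h.
  rewrite /= -![(_ + _ : _ -> _) _]/(_ + _) -![(- _ : _ -> _) _]/(- _) /=.
  rewrite addr0 /cst /=; apply: (le_trans (fC _)).
  rewrite addrK expr2 mulrA ler_wpM2r //.
  apply: (@le_trans _ _ ((`|C| + 1) * `|h|)).
    by rewrite ler_wpM2r // (le_trans (ler_norm C)) // lerDl.
  rewrite mulrC -ler_pdivlMr ?ltr_wpDl //; near: h.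
  apply/nbhs_ballP; exists (e / (`|C| + 1)); first by rewrite /= divr_gt0 ?ltr_wpDl.
  move=> h.
  by rewrite -ball_normE /= sub0r normrN => /ltW.
have diff0 : 'd f u = (0 : V -> R) :> (V -> R) by exact: diff_unique c0 E.
have df : differentiable f u by apply/diff_locallyP; rewrite diff0.
by split => // v; rewrite deriveE // diff0.
Unshelve. all: by end_near. Qed.

Lemma gradient_eq0_derive n (f : 'cV[R]_n -> R) u v :
  differentiable f u -> gradient f u = 0 -> 'D_v f u = 0.
Proof.
move=> df g0; rewrite deriveE // (matrix_sum_delta v) linear_sum big1 // => i _.
rewrite linear_sum big1 // => j _; rewrite linearZ /= -deriveE // ord1.
by have /matrixP/(_ i 0) := g0; rewrite !mxE => ->; rewrite scaler0.
Qed.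

(** Dividing the upper bound by t and letting t tend to 0 compares the derivative 0 with a. *)
Lemma slope_ge0 (V : normedModType R) (f : V -> R) (u v : V) (a b : R) :
  differentiable f u -> 'D_v f u = 0 ->
  (forall t, 0 < t <= 1 -> f (u + t *: v) <= f u + t * a + t ^+ 2 * b) -> 0 <= a.
Proof.
move=> df D0 fle; rewrite leNgt; apply/negP => a0.
have e0 : 0 < - a / 4 by rewrite divr_gt0 ?oppr_gt0.
have b1 : 0 < `|b| + 1 by rewrite ltr_wpDl.
have dfv : derivable f u v by exact: diff_derivable.
have /eqaddoP /(_ _ e0) /nbhs_ballP [d /= d0 near_le] := derivable_nbhs dfv.
(* Suppose a < 0. For this t the little-o remainder and t^2 b are each at most -a t / 4, which
   leaves 0 <= a t / 2, a contradiction. *)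
pose t := Num.min (Num.min 1 (d / 2)) (- a / 4 / (`|b| + 1)).
have t0 : 0 < t by rewrite !lt_min ltr01 divr_gt0 // divr_gt0.
have t1 : t <= 1 by rewrite /t !ge_min lexx.
have td : t < d.
  by rewrite /t !gt_min ltr_pdivrMr // ltr_pMr // ltr1n orbT.
have tb : t * b <= - a / 4.
  apply: (@le_trans _ _ (t * (`|b| + 1))).
    by rewrite ler_wpM2l ?(ltW t0) // (le_trans (ler_norm b)) // lerDl.
  by rewrite -ler_pdivlMr // /t ge_min lexx orbT.
have ball_t : ball (0 : R) d t.
  by rewrite -ball_normE /= sub0r normrN gtr0_norm.
have := near_le t ball_t.
rewrite /= -![(_ + _ : _ -> _) _]/(_ + _) -![(- _ : _ -> _) _]/(- _) /= D0.
rewrite [X in _ - X](_ : _ = f u); last first.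
  by rewrite -[LHS]/(f u + t *: 0) scaler0 addr0.
rewrite (gtr0_norm t0) ler_norml => /andP[+ _].
have /fle : 0 < t <= 1 by rewrite t0.
rewrite addrC /cst; move: (f _) (f u) => x y xy yx.
have : 0 <= t * (a / 2).
  have : t ^+ 2 * b <= t * (- a / 4) by rewrite expr2 -mulrA ler_wpM2l // ltW.
  lra.
by rewrite pmulr_rge0 // leNgt => /negP; apply; rewrite pmulr_llt0.
Qed.

End Calculus.

(** * Lower envelopes of families of functions *)

Section Infimum.
Context {R : realType} {n : nat} {I : Type}.
Variables (D : set I) (F : I -> 'cV[R]_n -> R) (c : 'cV[R]_n -> R).
Hypothesis D0 : D !=set0.
Hypothesis Fc : forall i x, D i -> c x <= F i x.

Definition lower_envelope x : R := inf [set F i x | i in D].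

Lemma lower_envelope_has_inf x : has_inf [set F i x | i in D].
Proof.
split; first by case: D0 => i Di; exists (F i x), i.
by exists (c x) => _ [i Di <-]; exact: Fc.
Qed.

Lemma lower_envelope_le i x : D i -> lower_envelope x <= F i x.
Proof. by move=> Di; apply: ge_inf; [exact: (lower_envelope_has_inf x).2|exists i]. Qed.

Lemma lower_envelope_ge x r : (forall i, D i -> r <= F i x) -> r <= lower_envelope x.
Proof.
move=> rF; apply: lb_le_inf; first exact: (lower_envelope_has_inf x).1.
by move=> _ [i Di <-]; exact: rF.
Qed.

(** Provides the extended-real infimum that [kantorovich_potential] is stated with. *)
Lemma ereal_inf_lower_envelope x :
  ereal_inf [set (F i x)%:E | i in D] = (lower_envelope x)%:E.
Proof.
have [F0 lbF] := lower_envelope_has_inf x; rewrite -ereal_inf_EFin //.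
by rewrite image_comp.
Qed.

(** A strict sublevel set of the envelope is the union of those of the [F i], hence open even for
    uncountable [D]. *)
Lemma measurable_lower_envelope : (forall i, D i -> continuous (F i)) ->
  measurable_fun setT lower_envelope.
Proof.
move=> cF; apply/measurable_EFinP; apply: usc_measurable_mx => r.
rewrite (_ : [set x | _] = \bigcup_(i in D) (F i @^-1` [set s | s < r])).
  apply: bigcup_open => i Di; apply: open_comp; last exact: open_lt.
  by move=> x _; exact: cF.
apply/seteqP; split => x /=; rewrite lte_fin.
  move=> /(inf_lt (lower_envelope_has_inf x).1) [_ [i Di <-] Fr]; exists i => //.
by move=> [i Di /= Fr]; apply: le_lt_trans (lower_envelope_le _ Di) Fr.
Qed.

End Infimum.

(** * The projection is an equilibrium *)

Lemma msupport_neq0 (R : realType) (n : nat) (nu : probability 'cV[R]_n R) :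
  msupport nu !=set0.
Proof.
apply/set0P/eqP => S0; have := msupport_compl0 nu.
by rewrite S0 setC0 probability_setT => /eqP; rewrite onee_eq0.
Qed.

Section Existence.
Context {R : realType} {m n : nat} (A : 'M[R]_(n, m)).
Hypothesis rankA : \rank A = m.
Variable nu : probability 'cV[R]_n R.
Hypothesis compact_supp : compact (msupport nu).
Local Notation B := (left_pinv A).
Local Notation S := (msupport nu).
Local Notation projection := (push B nu).

(** The c-transform of [gap] over supp nu. At a point A u it is, by Pythagoras, the squared distance
    to A B (supp nu). *)
Definition gap_conjugate : 'cV[R]_n -> R :=
  lower_envelope S (fun (y x : 'cV[R]_n) => cost x y - gap A y).

(** The value -oo off the support makes the dual constraint hold for every y. *)
Definition gap_potential (y : 'cV[R]_n) : \bar R :=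
  if y \in S then (gap A y)%:E else -oo%E.

Let gap_bounded : exists M, forall y, S y -> `|gap A y| <= M.
Proof.
apply: (compact_fun_bounded compact_supp).
by apply: continuous_subspaceT; exact: gap_continuous.
Qed.

Let gap_lbound : exists M, forall y x, S y -> - M <= cost x y - gap A y.
Proof.
have [M gapM] := gap_bounded; exists M => y x Sy.
have := gapM y Sy; have := cost_ge0 x y; have := ler_norm (gap A y); lra.
Qed.

Lemma gap_conjugate_range u y :
  S y -> gap_conjugate (A *m u) <= cost (A *m u) (A *m (B *m y)).
Proof.
move=> Sy; have [M gapM] := gap_lbound.
have := lower_envelope_le (msupport_neq0 nu) gapM (A *m u) Sy.
by rewrite {1}(cost_gap rankA u y) addrK.
Qed.

Lemma gap_conjugate_ge0 u : 0 <= gap_conjugate (A *m u).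
Proof.
have [M gapM] := gap_lbound.
apply: (lower_envelope_ge (msupport_neq0 nu) gapM) => y Sy.
by rewrite (cost_gap rankA u y) addrK cost_ge0.
Qed.

Lemma gap_conjugate_projection y : S y -> gap_conjugate (A *m (B *m y)) = 0.
Proof.
move=> Sy; apply/eqP; rewrite eq_le gap_conjugate_ge0 andbT.
apply: (le_trans (gap_conjugate_range _ Sy)).
by rewrite /cost subrr -(scale0r 0) dotpZl mul0r.
Qed.

Lemma gap_conjugate_measurable : measurable_fun setT gap_conjugate.
Proof.
have [M gapM] := gap_lbound.
apply: (measurable_lower_envelope (msupport_neq0 nu) gapM) => y _ x.
apply: (@cvgB _ _ _ (nbhs x)); last exact: cvg_cst.
exact: cost_continuousl.
Qed.

Local Notation gapE := (\int[nu]_y (gap A y)%:E)%E.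

Let measurable_supp : measurable S.
Proof. exact: closed_measurable_mx (@msupport_closed _ _ nu). Qed.

Lemma gap_conjugate_integrable :
  (push A projection).-integrable setT (EFin \o gap_conjugate) /\
  (\int[push A projection]_x (gap_conjugate x)%:E = 0)%E.
Proof.
(* The zero set contains A B (supp nu), so it has full measure, and it is measurable as a level
   set. *)
pose Z := [set x | gap_conjugate x = 0].
have mZ : measurable Z.
  rewrite -[Z]setTI.
  exact: (gap_conjugate_measurable measurableT (measurable_set1 0)).
have muZ : push A projection (~` Z) = 0%E.
  have sub : mulmx B @^-1` (mulmx A @^-1` (~` Z)) `<=` ~` S.
    by move=> y /= yZ Sy; apply: yZ; exact: gap_conjugate_projection.
  apply: subset_measure0 sub (msupport_compl0 nu); last exact: measurableC.
  have mAZ : measurable (mulmx A @^-1` (~` Z)).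
    rewrite -[X in measurable X]setTI.
    exact: (@measurable_mulmx R n m 1 A measurableT _ (measurableC mZ)).
  rewrite -[X in measurable X]setTI.
  exact: (@measurable_mulmx R m n 1 B measurableT _ mAZ).
have mg : measurable_fun setT (EFin \o gap_conjugate).
  by apply/measurable_EFinP; exact: gap_conjugate_measurable.
have int0 : (push A projection).-integrable setT (cst 0%E) by exact: integrable0.
have gZ x : Z x -> (EFin \o gap_conjugate) x = cst 0%E x by move=> /= ->.
have [? E] := integral_eq_conull mZ muZ gZ mg int0.
by split => //; rewrite E integral0.
Qed.

Lemma gap_potential_integrable :
  nu.-integrable setT gap_potential /\ (\int[nu]_y gap_potential y = gapE)%E.
Proof.
have gS y : S y -> gap_potential y = (EFin \o gap A) y.
  by move=> Sy; rewrite /gap_potential mem_set.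
apply: (integral_eq_conull measurable_supp (msupport_compl0 nu) gS); last first.
  exact: gap_integrable.
apply: (measurable_fun_ifT (measurable_mem measurable_supp) _ (measurable_cst _)).
apply/measurable_EFinP; apply: continuous_measurable_mx; exact: gap_continuous.
Qed.

(** The value of the pair is the integral of [gap], which is also the cost of an explicit coupling;
    weak duality makes the pair maximal. *)
Lemma gap_kantorovich_potential :
  kantorovich_potential (push A projection) nu gap_conjugate.
Proof.
have [M gapM] := gap_lbound.
have [ic icE] := gap_conjugate_integrable.
have [ip ipE] := gap_potential_integrable.
exists gap_potential.
  split.
    split=> // x y; rewrite /gap_potential; case: ifPn => [/set_mem Sy|_]; last first.
      by rewrite addeNy leNye.
    have := lower_envelope_le (msupport_neq0 nu) gapM x Sy.
    by rewrite -EFinD lee_fin lerBrDr.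
  move=> phi psi adm; rewrite [leRHS]/dual_value icE add0e ipE.
  have [gamma cgamma <-] := projection_coupling A nu.
  exact: weak_duality.
move=> x; rewrite -(ereal_inf_lower_envelope (msupport_neq0 nu) gapM); congr ereal_inf.
apply/seteqP; split => _ [y Sy <-]; exists y => //;
  by rewrite /gap_potential mem_set.
Qed.

(** Composed with A, the conjugate vanishes at u and lies between 0 and a multiple of |v - u|^2. *)
Lemma gap_conjugate_critical y (u := B *m y) : S y ->
  differentiable (gap_conjugate \o mulmx A) u /\
  gradient (gap_conjugate \o mulmx A) u = 0.
Proof.
move=> Sy.
have [C C0 normC] : exists2 C, 0 <= C & forall v : 'cV[R]_m,
    dotp (A *m v) (A *m v) <= C * `|v| ^+ 2.
  exists (n%:R * (m%:R * `|A|) ^+ 2) => [|v]; first by rewrite mulr_ge0 ?sqr_ge0.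
  apply: (le_trans (dotp_le_norm _)); rewrite -mulrA -exprMn ler_wpM2l //.
  by rewrite ler_pXn2r ?nnegrE ?mulr_ge0 // mx_norm_mulmx.
have [|df D0] := @quadratic_differentiable R _ (gap_conjugate \o mulmx A) u C.
  move=> v /=; rewrite /u gap_conjugate_projection // subr0.
  rewrite ger0_norm ?gap_conjugate_ge0 //.
  apply: (le_trans (gap_conjugate_range v Sy)).
  by rewrite /cost -mulmxBr; exact: normC.
split => //; apply/matrixP => i j; rewrite !mxE; exact: D0.
Qed.

(** The image of the compact support is closed and has full measure. *)
Lemma msupport_projection : msupport projection `<=` mulmx B @` S.
Proof.
have closedBS : closed (mulmx B @` S).
  apply: compact_closed; first exact: norm_hausdorff.
  apply: continuous_compact => //.
  by apply: continuous_subspaceT => y; exact: continuous_mulmx.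
apply: (msupport_sub_closed closedBS).
have sub : mulmx B @^-1` (~` (mulmx B @` S)) `<=` ~` S.
  by move=> y nSy Sy; apply: nSy; exists y.
apply: subset_measure0 sub (msupport_compl0 nu); last exact: measurableC.
rewrite -[X in measurable X]setTI.
apply: (@measurable_mulmx R m n 1 B measurableT _ (measurableC _)).
exact: closed_measurable_mx closedBS.
Qed.

Lemma projection_equilibrium : equilibrium A nu projection.
Proof.
have critical u : msupport projection u ->
    differentiable (gap_conjugate \o mulmx A) u /\
    gradient (gap_conjugate \o mulmx A) u = 0.
  by move=> /msupport_projection [y Sy <-]; exact: gap_conjugate_critical.
split; last by exists gap_conjugate => //; exact: gap_kantorovich_potential.
(* The constant curve moves with zero velocity, which equals minus the gradient on the support,
   hence almost everywhere. *)
exists (fun _ _ => 0); split => [t t0|t t0|zeta _ s t st rate].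
- exists gap_conjugate; first exact: gap_kantorovich_potential.
  exists (~` msupport projection); split.
  + apply: measurableC; apply: closed_measurable_mx; exact: msupport_closed.
  + exact: msupport_compl0.
  + move=> u /= nu_u su; apply: nu_u; have [df ->] := critical u su.
    by rewrite oppr0.
- split; first exact: measurable_cst.
  rewrite (_ : (fun _ => _) = cst 0%E); first exact: integrable0.
  by apply/funext => u; rewrite -(scale0r 0) dotpZl mul0r.
have rate0 r : rate r = 0.
  rewrite /rate (_ : (fun _ => _) = cst 0) ?Rintegral_cst ?mul0r //.
  by apply/funext => u; rewrite dotpC -(scale0r 0) dotpZl mul0r.
rewrite (_ : rate = cst 0); last by apply/funext.
split; first exact: integrable0.
by rewrite subrr Rintegral_cst // mul0r.
Qed.

End Existence.

(** * Uniqueness of the equilibrium *)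

(** The mean value theorem on the segment from y to z, which stays in the ball. *)
Lemma derive0_ball_constant (R : realType) (V : normedModType R) (f : V -> R)
    (y z : V) (r : R) :
  (forall x v, ball y r x -> is_derive x v f 0) -> ball y r z -> f z = f y.
Proof.
move=> f0 yz; pose h (t : R) := f (y + t *: (z - y)).
have in_ball (t : R) : 0 <= t <= 1 -> ball y r (y + t *: (z - y)).
  move=> /andP[t0 t1]; move: yz; rewrite -!ball_normE /= opprD addNKr normrN normrZ.
  rewrite distrC ger0_norm //; apply: le_lt_trans.
  by rewrite ler_piMl.
have dh (t : R) : 0 <= t <= 1 -> is_derive t (1 : R) h (0 : R).
  move=> /in_ball yt; have [df Df] := f0 _ (z - y) yt.
  have E : (fun s : R => s^-1 *: ((h \o shift t) (s *: 1) - h t)) =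
      (fun s => s^-1 *: ((f \o shift (y + t *: (z - y))) (s *: (z - y))
                - f (y + t *: (z - y)))).
    apply/funext => s; rewrite /h /= [s *: 1]mulr1.
    by rewrite scalerDl addrCA.
  by split; rewrite /derivable /derive E.
have [||t _] := @MVT R h (fun=> 0) 0 1 ltr01.
- by move=> t; rewrite in_itv /= => /andP[/ltW t0 /ltW t1]; apply: dh; rewrite t0.
- apply: derivable_within_continuous => t; rewrite in_itv /=.
  by move=> /dh [].
- rewrite mul0r /h scale1r scale0r addr0 subrKC => /eqP.
  by rewrite subr_eq0 => /eqP.
Qed.

Lemma derive0_constant (R : realType) (V : normedModType R) (f : V -> R)
    (U : set V) :
  open U -> connected U -> (forall x v, U x -> is_derive x v f 0) ->
  forall y z, U y -> U z -> f y = f z.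
Proof.
move=> oU cU f0 y z Uy Uz.
have near_const x : U x -> \forall w \near x, f w = f x.
  move=> Ux; have /nbhs_ballP [e /= e0 eU] := open_nbhs_nbhs (conj oU Ux).
  apply/nbhs_ballP; exists e => // w xw.
  by apply: derive0_ball_constant xw => w' v /eU; exact: f0.
(* An arbitrary predicate [P] covers both a level set and its complement in [U]. *)
have open_level P : open [set x | U x /\ P (f x)].
  rewrite openE => x [Ux Px]; rewrite /interior.
  have := near_const x Ux; have := open_nbhs_nbhs (conj oU Ux).
  by apply: filterS2 => w Uw fw; split=> //; rewrite fw.
have UE := cU (U `&` [set x | f x = f y]).
have : (U `&` [set x | f x = f y]) z; last by case.
rewrite UE //; first by exists y.
  exists [set x | U x /\ f x = f y]; first exact: (open_level (fun r => r = f y)).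
  by apply/seteqP; split => [x []//|x [? []]].
exists (~` [set x | U x /\ f x <> f y]).
  exact/open_closedC/(open_level (fun r => r <> f y)).
apply/seteqP; split => x [Ux fx]; split => //; first by move=> [].
by apply: contrapT => nfx; exact: fx.
Qed.

(** * Optimal dual pair with critical potential on the support *)

Section Equilibrium.
Context {R : realType} {m n : nat} (A : 'M[R]_(n, m)).
Hypothesis rankA : \rank A = m.
Variable nu : probability 'cV[R]_n R.
Hypothesis compact_supp : compact (msupport nu).
Variable U : set 'cV[R]_n.
Hypotheses (openU : open U) (connectedU : connected U).
Hypothesis suppE : msupport nu = closure U.
Variable rho : probability 'cV[R]_m R.
Variables (phi : 'cV[R]_n -> R) (psi : 'cV[R]_n -> \bar R).
Hypothesis kpair : kantorovich_pair (push A rho) nu (EFin \o phi) psi.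
Hypothesis phi_inf : forall x, (phi x)%:E =
  ereal_inf [set ((cost x y)%:E - psi y)%E | y in msupport nu].
Local Notation B := (left_pinv A).
Local Notation S := (msupport nu).
Local Notation T := (msupport rho).
Local Notation g := (phi \o mulmx A).
Hypothesis critical : forall u, T u -> differentiable g u /\ gradient g u = 0.

Let phi_psi_le x y : ((phi x)%:E + psi y <= (cost x y)%:E)%E.
Proof. by have [[_ _ le_cost] _] := kpair; exact: le_cost. Qed.

Let derive_g u v : T u -> is_derive u v g 0.
Proof.
move=> /critical [dg g0]; split; first exact: diff_derivable.
exact: gradient_eq0_derive.
Qed.

(** As an infimum of [cost x y - psi y] over supp nu, phi inherits increment bounds that are uniform
    in y. *)
Lemma potential_le x x' K :
  (forall y, S y -> cost x' y <= cost x y + K) -> phi x' <= phi x + K.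
Proof.
move=> costK; rewrite -lerBlDr -lee_fin phi_inf.
apply: le_ereal_inf_tmp => _ [y Sy <-].
have := phi_psi_le x' y; have := costK y Sy.
case: (psi y) => [r||] /=; rewrite ?leey // -EFinD lee_fin -EFinB lee_fin.
by lra.
Qed.

(** Moving A u towards the origin changes its cost to each y in supp nu, at first order, by at most
    M - |A u|^2, where M bounds |y|^2. As g is critical at u, this rate cannot be negative. *)
Let T_bounded : exists M, forall u, T u -> dotp (A *m u) (A *m u) <= M.
Proof.
have c0 : continuous (fun y : 'cV[R]_n => cost y 0) by exact: cost_continuousl.
have [M costM] := compact_fun_bounded compact_supp (continuous_subspaceT c0).
exists M => u Tu; set x := A *m u.
have [dg _] := critical Tu.
rewrite -subr_ge0; apply: (slope_ge0 (v := - u) (b := dotp x x) dg).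
  by have [_] := derive_g (- u) Tu.
move=> t /andP[t0 t1]; rewrite /= -addrA; apply: potential_le => y Sy.
rewrite mulmxDr -scalemxAr mulmxN -/x cost_segment.
have := le_trans (ler_norm _) (costM y Sy); rewrite /cost subr0 => yM.
have := dotp_ge0 (x - y).
rewrite !(dotpDl, dotpDr, dotpNl, dotpNr, opprK, mulrN) (dotpC y x).
move=> xy; rewrite -addrA lerD2l lerD2r ler_wpM2l ?(ltW t0) //.
move: (dotp x x) (dotp x y) (dotp y y) xy yM => p q s; lra.
Qed.

Let T_compact : compact T.
Proof.
apply: bounded_closed_compact_cV; last exact: msupport_closed.
have [M TM] := T_bounded; have [D D0 normD] := mx_norm_cost_le rankA.
exists (D * M + 1); split => [|r Mr u Tu]; first exact: num_real.
have := normD u 0; rewrite mulmx0 /cost !subr0 => uD.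
have {}uD : `|u| ^+ 2 <= D * M by apply: (le_trans uD); rewrite ler_wpM2l // TM.
(* Turns the bound on |u|^2 into one on |u| without a square root. *)
have : `|u| *+ 2 <= `|u| ^+ 2 + 1.
  by rewrite -subr_ge0 (_ : _ - _ = (`|u| - 1) ^+ 2) ?sqr_ge0 //; ring.
move=> u2; apply: le_trans (ltW Mr).
have : `|u| *+ 2 <= D * M + 1 by apply: (le_trans u2); rewrite lerD2r.
by apply: le_trans; rewrite mulr2n lerDl.
Qed.

Let g_continuous : {within T, continuous g}.
Proof.
apply: continuous_in_subspaceT => u /set_mem /critical [dg _].
exact: differentiable_continuous.
Qed.

Let g_bounded : exists G, forall u, T u -> `|g u| <= G.
Proof. exact: (compact_fun_bounded T_compact g_continuous). Qed.

(** The c-transform of g restricted to supp rho, where compactness makes it finite and attained. *)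
Definition conjugate : 'cV[R]_n -> R :=
  lower_envelope T (fun u y => cost (A *m u) y - g u).

Let conjugate_lbound : exists G, forall u y, T u -> - G <= cost (A *m u) y - g u.
Proof.
have [G gG] := g_bounded; exists G => u y Tu.
have := le_trans (ler_norm _) (gG u Tu); have := cost_ge0 (A *m u) y; lra.
Qed.

Lemma conjugate_le u y : T u -> g u + conjugate y <= cost (A *m u) y.
Proof.
move=> Tu; have [G lb] := conjugate_lbound.
by rewrite addrC -lerBrDr; exact: (lower_envelope_le (msupport_neq0 rho) lb y Tu).
Qed.

Lemma conjugate_attained y : exists2 u, T u & conjugate y = cost (A *m u) y - g u.
Proof.
have [G lb] := conjugate_lbound.
have cF : {within T, continuous (fun u => cost (A *m u) y - g u)}.
  apply: continuous_in_subspaceT => u /set_mem /critical [dg _].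
  apply: (@cvgB _ _ _ (nbhs u)); last exact: differentiable_continuous.
  exact: (continuous_comp (@continuous_mulmx R n m 1 A u) (@cost_continuousl R n y _)).
have [u /set_mem Tu umin] := compact_EVT_min (msupport_neq0 rho) T_compact cF.
exists u => //; apply/eqP; rewrite eq_le lerBrDr addrC conjugate_le //=.
apply: (lower_envelope_ge (msupport_neq0 rho) lb) => v Tv.
exact/umin/mem_set.
Qed.

Lemma conjugate_integrable : nu.-integrable setT (EFin \o conjugate).
Proof.
have [G lb] := conjugate_lbound; have [u0 Tu0] := msupport_neq0 rho.
have [M costM] := compact_fun_bounded compact_supp
  (continuous_subspaceT (@cost_continuousr R n (A *m u0))).
apply: (@bounded_conull_integrable _ _ _ _ S _ (`|G| + (M + `|g u0|))).
- exact: closed_measurable_mx (@msupport_closed _ _ nu).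
- exact: msupport_compl0.
- move=> y Sy; have := conjugate_le y Tu0.
  have : - G <= conjugate y.
    by apply: (lower_envelope_ge (msupport_neq0 rho) lb) => u; exact: lb.
  have := le_trans (ler_norm _) (costM y Sy); have := costM y Sy.
  have := ler_norm G; have := ler_norm (- g u0); rewrite normrN.
  have := normr_ge0 (cost (A *m u0) y); have := normr_ge0 G; have := normr_ge0 (g u0).
  move=> h1 h2 h3 h4 h5 h6 h7 h8 h9; rewrite ler_norml; apply/andP; split; lra.
- apply: (measurable_lower_envelope (msupport_neq0 rho) lb) => u _ y.
  apply: (@cvgB _ _ _ (nbhs y)); last exact: cvg_cst.
  exact: cost_continuousr.
Qed.

Let g_integrable : rho.-integrable setT (EFin \o g).
Proof.
have [G gG] := g_bounded.
apply: (bounded_conull_integrable _ (msupport_compl0 rho) gG).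
  exact: closed_measurable_mx (@msupport_closed _ _ rho).
have [[/measurable_int/measurable_EFinP mphi _ _] _] := kpair.
exact: (measurableT_comp mphi (@measurable_mulmx R n m 1 A)).
Qed.

Let dual_valueE :
  dual_value (push A rho) nu (EFin \o phi) psi =
  (\int[rho]_u (g u)%:E + \int[nu]_y psi y)%E.
Proof.
have [[iphi _ _] _] := kpair; congr (_ + _)%E.
exact: (integral_pushforward (@measurable_mulmx R n m 1 A)
  (measurable_int _ iphi) g_integrable measurableT).
Qed.

(* Replacing psi by the conjugate of g over the support of rho is admissible,
   so optimality forces equality almost everywhere. *)
Lemma psi_eq_conjugate : exists N, [/\ measurable N, nu N = 0%E &
  forall y, ~ N y -> psi y = (conjugate y)%:E].
Proof.
have [[iphi ipsi _] opt] := kpair.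
have mT : measurable T := closed_measurable_mx (@msupport_closed _ _ rho).
have le_cost u y : T u -> g u + conjugate y <= cost (A *m u) y.
  exact: conjugate_le.
have [phi' adm' E'] := dual_extension rankA mT (msupport_compl0 rho) g_integrable
  conjugate_integrable le_cost.
have := opt _ _ adm'; rewrite E' dual_valueE leeD2lE; last first.
  exact: (integrable_fin_num measurableT g_integrable).
move=> int_le.
(* This pointwise bound and the reverse inequality [int_le] between integrals force the nonnegative
   difference to integrate to 0. *)
have psi_le y : (psi y <= (conjugate y)%:E)%E.
  have [u Tu ->] := conjugate_attained y.
  have := phi_psi_le (A *m u) y; case: (psi y) => [r||] //=; rewrite ?leNye //.
  by rewrite -EFinD !lee_fin lerBrDl.
have iD : nu.-integrable setT (fun y => (conjugate y)%:E - psi y)%E.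
  exact: (integrableB measurableT conjugate_integrable ipsi).
have D0 y : (0 <= (conjugate y)%:E - psi y)%E.
  by rewrite subre_ge0.
have intD : (\int[nu]_y `|(conjugate y)%:E - psi y| = 0)%E.
  rewrite (eq_integral (fun y => (conjugate y)%:E - psi y)%E); last first.
    by move=> y _; rewrite gee0_abs.
  rewrite (integralB measurableT conjugate_integrable ipsi).
  apply/eqP; rewrite eq_le sube_le0 int_le /=.
  rewrite -(integralB measurableT conjugate_integrable ipsi).
  by apply: integral_ge0 => y _; exact: D0.
have [N [mN N0 subN]] :=
  (ae_eq_integral_abs nu measurableT (measurable_int _ iD)).1 intD.
exists N; split=> // y Ny.
have : ((conjugate y)%:E - psi y = 0)%E.
  by apply: contrapT => neq; apply: Ny; apply: subN => h; apply: neq; exact: h.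
case: (psi y) (psi_le y) => [r||] //= _ => /eqP; rewrite -EFinB eqe subr_eq0.
by move=> /eqP ->.
Qed.

(* If the cost minus g is minimal at u, differentiating there yields the
   normal equation for u. *)
Lemma contact_projection u y : T u ->
  (forall u', g u' - g u <= cost (A *m u') y - cost (A *m u) y) ->
  u = B *m y.
Proof.
move=> Tu gle; apply: normal_equation_sol => //.
set w := A^T *m (A *m u - y).
have [dg _] := critical Tu.
have : 0 <= 2 * dotp (A *m u - y) (A *m - w).
  apply: (slope_ge0 (v := - w) (b := dotp (A *m - w) (A *m - w)) dg).
    by have [_] := derive_g (- w) Tu.
  move=> t _; have := gle (u + t *: - w).
  by rewrite mulmxDr -scalemxAr cost_segment; lra.
rewrite dotpC dotp_mulmxl -/w dotpNl mulrN oppr_ge0 pmulr_rle0 // => w0.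
by apply: dotp_eq0; apply/eqP; rewrite eq_le w0 dotp_ge0.
Qed.

(** Where psi equals the conjugate, the minimum over T is attained at some u. Admissibility of (phi,
    psi) makes u minimal among all u', also outside T, so the normal equation gives u = B y. *)
Lemma contact : exists Y, [/\ measurable Y, nu (~` Y) = 0%E & forall y, Y y ->
  [/\ S y, T (B *m y) & psi y = (gap A y - g (B *m y))%:E]].
Proof.
have [N [mN N0 psiE]] := psi_eq_conjugate.
have mS : measurable S := closed_measurable_mx (@msupport_closed _ _ nu).
exists (S `\` N); split=> [||y [Sy Ny]].
- exact: measurableD.
- have mY : measurable (~` (S `\` N)) by apply: measurableC; exact: measurableD.
  apply: (measure_negligible mY).
  rewrite setDE setCI setCK; apply: negligibleU.
    apply/negligibleP; [exact: measurableC|exact: msupport_compl0].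
  exact/negligibleP.
have [u Tu uE] := conjugate_attained y.
have uBy : u = B *m y.
  apply: contact_projection => // u'.
  have := phi_psi_le (A *m u') y; rewrite psiE // -EFinD lee_fin uE.
  rewrite /=; lra.
by rewrite -{1}uBy; split => //; rewrite psiE // uE uBy.
Qed.

(** Upgrades almost every y to every y of supp nu: a closed set of full measure contains the
    support. *)
Lemma supp_in_closed (P : set 'cV[R]_n) : closed P ->
  (forall y, S y -> T (B *m y) -> psi y = (gap A y - g (B *m y))%:E -> P y) ->
  S `<=` P.
Proof.
move=> cP inP; have [Y [mY Y0 YE]] := contact.
apply: msupport_sub_closed => //.
have sub : ~` P `<=` ~` Y.
  by move=> y Py /YE [Sy Ty psiE]; apply: Py; exact: inP.
exact: (subset_measure0 (measurableC (closed_measurable_mx cP))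
  (measurableC mY) sub Y0).
Qed.

Lemma supp_projection y : S y -> T (B *m y).
Proof.
move: y; apply: supp_in_closed => //.
apply: preimage_closed; last exact: msupport_closed.
by move=> y _; exact: continuous_mulmx.
Qed.

Lemma potential_constant : exists c, forall y, S y -> g (B *m y) = c.
Proof.
have /set0P [y0] : U != set0.
  apply/negP => /eqP U0; have [y] := msupport_neq0 nu.
  by rewrite suppE U0 closure0.
move=> Uy0; exists (g (B *m y0)).
have SU : U `<=` S by rewrite suppE; exact: subset_closure.
have k0 y v : U y -> is_derive y v (g \o mulmx B) 0.
  move=> /SU /supp_projection Ty; have [dg Dg] := derive_g (B *m v) Ty.
  have E : (fun h : R => h^-1 *: (((g \o mulmx B) \o shift y) (h *: v)
      - (g \o mulmx B) y)) =
      (fun h => h^-1 *: ((g \o shift (B *m y)) (h *: (B *m v)) - g (B *m y))).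
    by apply/funext => h /=; rewrite mulmxDr -scalemxAr.
  by split; rewrite /derivable /derive E.
have kU y : U y -> g (B *m y) = g (B *m y0).
  by move=> Uy; exact: (derive0_constant openU connectedU k0 Uy Uy0).
(* Continuity of g at B y extends the constant from U to its closure. *)
move=> y Sy; apply/eqP; rewrite -subr_eq0 -normr_eq0 eq_le normr_ge0 andbT.
apply/ler_addgt0Pl => e e0; rewrite addr0.
have gc : {for y, continuous (g \o mulmx B)}.
  apply: continuous_comp; first exact: continuous_mulmx.
  by apply: differentiable_continuous; have [] := critical (supp_projection Sy).
have near_e : \forall z \near y, `|g (B *m y) - g (B *m z)| <= e.
  by move/cvgrPdist_le : gc; apply.
have : closure U y by rewrite -suppE.
by move=> /(_ _ near_e) [z [/kU -> ]].
Qed.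

Lemma cost_projection_eq0 u y : cost (A *m u) (A *m (B *m y)) = 0 -> u = B *m y.
Proof.
move=> /dotp_eq0 /eqP; rewrite subr_eq0 => /eqP AuE.
by rewrite -[LHS](left_pinvKv rankA) AuE left_pinvKv.
Qed.

Let dist_projection_continuous x : continuous (fun y => cost x (A *m (B *m y))).
Proof.
rewrite (_ : (fun _ => _) = cost x \o mulmx (A *m B)).
  move=> y; exact: (continuous_comp (@continuous_mulmx R n n 1 (A *m B) y)
    (@cost_continuousr R n x _)).
by apply/funext => y; rewrite /= mulmxA.
Qed.

Lemma potential_constant_supp c : (forall y, S y -> g (B *m y) = c) ->
  forall u, T u -> g u = c.
Proof.
move=> gc u Tu; pose d y := cost (A *m u) (A *m (B *m y)).
have [y1 /set_mem Sy1 dmin] : exists2 y1, y1 \in S & forall y, y \in S -> d y1 <= d y.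
  apply: (compact_EVT_min (msupport_neq0 nu) compact_supp).
  by apply: continuous_subspaceT; exact: dist_projection_continuous.
(* Admissibility at A B y gives psi y <= gap y - c, which bounds the infimum defining phi from
   below. *)
have gu_ge : c + d y1 <= g u.
  rewrite -lee_fin phi_inf; apply: le_ereal_inf_tmp => _ [y Sy <-].
  have := phi_psi_le (A *m (B *m y)) y; have := gc y Sy; rewrite /= => ->.
  have := dmin y (mem_set Sy); rewrite (cost_gap rankA u y) -/(d y) /gap.
  case: (psi y) => [r||] /=; rewrite ?leey // -EFinD -EFinB !lee_fin; lra.
(* On the contact set psi y = gap y - c, whence the upper bound; it is a closed condition on y. *)
have gle u' y : S y -> g u' <= c + cost (A *m u') (A *m (B *m y)).
  move: y; apply: supp_in_closed.
    apply: (@preimage_closed _ _ _ [set s | g u' <= s]); last exact: closed_ge.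
    move=> y _; apply: (@cvgD _ _ _ (nbhs y)); first exact: cvg_cst.
    exact: dist_projection_continuous.
  move=> y Sy _ psiE; have := phi_psi_le (A *m u') y.
  rewrite psiE gc // -EFinD lee_fin (cost_gap rankA u' y) /=; lra.
have [dg _] := critical Tu.
(* Moving u towards B y1 lowers the upper bound at rate 2 d(y1), while g is critical at u. *)
have : 0 <= - 2 * d y1.
  apply: (slope_ge0 (v := B *m y1 - u) (b := d y1) dg).
    by have [_] := derive_g (B *m y1 - u) Tu.
  move=> t _; apply: (le_trans (gle _ y1 Sy1)).
  rewrite mulmxDr -scalemxAr mulmxBr cost_segment -/(d y1).
  rewrite -(opprB (A *m u)) dotpNr dotpNl dotpNr opprK -[dotp _ _]/(d y1).
  move: gu_ge => /=; lra.
have := cost_ge0 (A *m u) (A *m (B *m y1)); rewrite -/(d y1) => d0 d1.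
by rewrite (@cost_projection_eq0 u y1) ?gc // -/(d y1); lra.
Qed.

(** Almost everywhere g = c and psi = gap - c; the constants cancel because both measures have mass
    1. *)
Lemma kantorovich_value :
  (dual_value (push A rho) nu (EFin \o phi) psi = \int[nu]_y (gap A y)%:E)%E.
Proof.
have [c gc] := potential_constant.
have gT u : T u -> (EFin \o g) u = (EFin \o cst c) u.
  by move=> Tu; congr EFin; exact: potential_constant_supp.
have mT : measurable T := closed_measurable_mx (@msupport_closed _ _ rho).
have icst d (X : measurableType d) (P : probability X R) :
    P.-integrable setT (EFin \o cst c) /\ (\int[P]_x (cst c x)%:E = c%:E)%E.
  split; first exact: finite_measure_integrable_cst.
  have -> : (\int[P]_x (cst c x)%:E = c%:E * P setT)%E.
    exact: (integral_cst P measurableT c%:E).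
  by rewrite probability_setT mule1.
have [icr icrE] := icst _ _ rho; have [icn icnE] := icst _ _ nu.
have [_ gE] := integral_eq_conull mT (msupport_compl0 rho) gT
  (measurable_int _ g_integrable) icr.
have [Y [mY Y0 YE]] := contact.
have [[_ ipsi _] _] := kpair.
have iB := integrableB measurableT (gap_integrable A compact_supp) icn.
have psiY y : Y y -> psi y = ((EFin \o gap A) \- (EFin \o cst c))%E y.
  by move=> /YE [Sy _ ->]; rewrite gc.
have [_ psiE] := integral_eq_conull mY Y0 psiY (measurable_int _ ipsi) iB.
have fG : (\int[nu]_y (gap A y)%:E)%E \is a fin_num.
  exact: (integrable_fin_num measurableT (gap_integrable A compact_supp)).
rewrite dual_valueE gE icrE psiE.
rewrite (integralB measurableT (gap_integrable A compact_supp) icn) icnE.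
by rewrite -(fineK fG) -EFinB -EFinD subrKC.
Qed.

End Equilibrium.

Lemma bounded_closure (R : realType) (n : nat) (U : set 'cV[R]_n) :
  bounded_set U -> bounded_set (closure U).
Proof.
move=> [M [_ UM]]; exists (M + 1); split; first exact: num_real.
move=> r Mr x Ux; apply: (le_trans _ (ltW Mr)).
have cF : closed [set y : 'cV[R]_n | `|y| <= M + 1].
  apply: (@preimage_closed _ _ _ [set s | s <= M + 1]); last exact: closed_le.
  by move=> y _; exact: norm_continuous.
apply: cF; apply: closureS Ux => y Uy.
by apply: UM => //; rewrite ltrDl.
Qed.

Theorem theorem4p7 (R : realType) (m n : nat) (A : 'M[R]_(n, m))
    (rho_star : probability 'cV[R]_n R) (U : set 'cV[R]_n)
    (lt_mn : (m < n)%N) (rankA : \rank A = m)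
    (ac_rho_star : rho_star `<< @lebesgue_outer R n)
    (openU : open U) (connectedU : connected U) (boundedU : bounded_set U)
    (supp_rho_star : msupport rho_star = closure U) :
  (W2_minimizer A rho_star (push (left_pinv A) rho_star) /\
   forall rho, W2_minimizer A rho_star rho ->
     eq_prob rho (push (left_pinv A) rho_star)) /\
  (equilibrium A rho_star (push (left_pinv A) rho_star) /\
   forall rho, equilibrium A rho_star rho ->
     eq_prob rho (push (left_pinv A) rho_star)).
Proof.
have compact_supp : compact (msupport rho_star).
  rewrite supp_rho_star; apply: bounded_closed_compact_cV.
    exact: bounded_closure.
  exact: closed_closure.
split; split.
- exact: projection_minimizer.
- by move=> rho; exact: minimizer_unique.
- exact: projection_equilibrium.
move=> rho [_ [phi [psi kpair phi_inf] critical]].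
apply: saturated_eq_projection => // phi' psi' adm.
(* The equilibrium's own pair has value the integral of [gap], and by optimality no dual pair
   exceeds it. *)
rewrite -(kantorovich_value rankA compact_supp openU connectedU supp_rho_star
  kpair phi_inf critical).
by have [_ opt] := kpair; exact: opt.
Qed.
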